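(* A finite simple graph $G$ is $\{P_5,\overline{P_5}\}$-free if and only if at least one of the following holds: (a) $G$ is a split graph; (b) $G$ is a pentagon (isomorphic to $C_5$); (c) $G$ is obtained by substitution from smaller $\{P_5,\overline{P_5}\}$-free graphs; (d) $G$ or $\overline{G}$ is obtained by split unification from smaller $\{P_5,\overline{P_5}\}$-free graphs.
   Context: $P_5$ is the path on 5 vertices, $C_5$ the 5-cycle, $\overline{G}$ the complement of $G$. A graph is $\{P_5,\overline{P_5}\}$-free if it has no induced subgraph isomorphic to $P_5$ or to $\overline{P_5}$. A graph is split if its vertex set can be partitioned into a clique and a stable set. Substitution: given vertex-disjoint graphs $G_0$ and $H$ and a vertex $x$ of $G_0$, the graph obtained by substituting $H$ for $x$ has vertex set $V(G_0\setminus x)\cup V(H)$, consists of the union of $G_0\setminus x$ and $H$, plus all edges between $V(H)$ and the neighbors of $x$ in $G_0$. ''$G$ is obtained by substitution from smaller graphs in a class'' means $G$ is isomorphic to such a graph where $G_0$ and $H$ both have fewer vertices than $G$ (equivalently, both have at least two vertices) and both lie in the class. For $S\subseteq V(G)$ and $v\notin S$: $v$ is complete to $S$ if adjacent to all of $S$, anticomplete if adjacent to none, mixed on $S$ otherwise; a set is complete (anticomplete) to a disjoint set if each of its vertices is. An anticomponent of $S$ is a subset of $S$ inducing a connected component of the complement of $G[S]$. Composable pair: let $A,B,C,L,T$ be pairwise disjoint sets with $A,C$ non-empty, and $a^*,c^*$ two distinct vertices not in $A\cup B\cup C\cup L\cup T$. $G_1$ is a graph on $A\cup B\cup L\cup T\cup\{c^*\}$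 such that $L$ is a (possibly empty) clique, $T$ is a (possibly empty) stable set, $A$ is complete to $B$ and anticomplete to $T$, some vertex of $A$ is complete to $L$, and $c^*$ is complete to $B\cup L$ and anticomplete to $A\cup T$ (other adjacencies arbitrary). $G_2$ is a graph on $B\cup C\cup L\cup T\cup\{a^*\}$ such that $G_2[B\cup L\cup T]=G_1[B\cup L\cup T]$, $T$ is anticomplete to $C$, $L$ is complete to $B\cup C$, $a^*$ is complete to $B\cup L$ and anticomplete to $C\cup T$, some vertex of $C$ is complete to $B$, and no vertex of $C$ is mixed on any anticomponent of $B$ (other adjacencies arbitrary). Its split unification is the graph on $A\cup B\cup C\cup L\cup T$ whose restriction to $A\cup B\cup L\cup T$ is $G_1\setminus c^*$, whose restriction to $B\cup C\cup L\cup T$ is $G_2\setminus a^*$, and in which $A$ is anticomplete to $C$. ''$G$ is obtained by split unification from smaller graphs in a class'' means $G$ is (isomorphic to) the split unification of a composable pair $(G_1,G_2)$ with $G_1,G_2$ in the class and each having fewer vertices than $G$. *)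

(* Defs.v *)
From HB Require Import structures.
From mathcomp Require Import all_boot.

Set Implicit Arguments.
Unset Strict Implicit.
Unset Printing Implicit Defensive.

Record sgraph (V : finType) := SGraph {
  adj : rel V;
  adj_sym : symmetric adj;
  adj_irrefl : irreflexive adj
}.

Definition iso (V W : finType) (G : sgraph V) (H : sgraph W) : Prop :=
  exists2 f : V -> W, bijective f & forall x y, adj H (f x) (f y) = adj G x y.

Section Complement.
Variables (V : finType) (G : sgraph V).
Let cadj := [rel x y | (x != y) && ~~ adj G x y].
Fact compl_sym : symmetric cadj.
Proof. by move=> x y; rewrite /= eq_sym adj_sym. Qed.
Fact compl_irrefl : irreflexive cadj.
Proof. by move=> x; rewrite /= eqxx. Qed.
Definition compl : sgraph V := SGraph compl_sym compl_irrefl.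
End Complement.

Section Induced.
Variables (V : finType) (G : sgraph V) (S : {set V}).
Let iadj := [rel x y : {v : V | v \in S} | adj G (val x) (val y)].
Fact induced_sym : symmetric iadj.
Proof. by move=> x y; rewrite /= adj_sym. Qed.
Fact induced_irrefl : irreflexive iadj.
Proof. by move=> x; rewrite /= adj_irrefl. Qed.
Definition induced : sgraph {v : V | v \in S} := SGraph induced_sym induced_irrefl.
End Induced.

Section PathGraph.
Variable n : nat.
Let padj := [rel i j : 'I_n | (i.+1 == j) || (j.+1 == i)].
Fact path_graph_sym : symmetric padj.
Proof. by move=> i j; rewrite /= orbC. Qed.
Fact path_graph_irrefl : irreflexive padj.
Proof. by move=> i; rewrite /= orbb gtn_eqF. Qed.
Definition path_graph : sgraph 'I_n := SGraph path_graph_sym path_graph_irrefl.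
End PathGraph.

Section CycleGraph.
Variable n : nat.
Let cadj := [rel i j : 'I_n | (i != j) && ((ordS i == j) || (ordS j == i))].
Fact cycle_graph_sym : symmetric cadj.
Proof. by move=> i j; rewrite /= eq_sym orbC. Qed.
Fact cycle_graph_irrefl : irreflexive cadj.
Proof. by move=> i; rewrite /= eqxx. Qed.
Definition cycle_graph : sgraph 'I_n := SGraph cycle_graph_sym cycle_graph_irrefl.
End CycleGraph.

Definition P5 := path_graph 5.
Definition C5 := cycle_graph 5.

Definition free_of (W : finType) (H : sgraph W) (V : finType) (G : sgraph V) : Prop :=
  ~ exists S : {set V}, iso (induced G S) H.

Definition P5_coP5_free (V : finType) (G : sgraph V) : Prop :=
  free_of P5 G /\ free_of (compl P5) G.

Section Sets.
Variables (V : finType) (G : sgraph V).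
Implicit Types (v : V) (S X Y : {set V}).

Definition clique S : Prop := {in S &, forall x y, x != y -> adj G x y}.
Definition stable S : Prop := {in S &, forall x y, ~~ adj G x y}.

Definition vcomplete v S : bool := [forall y in S, adj G v y].
Definition vanticomplete v S : bool := [forall y in S, ~~ adj G v y].
Definition mixed v S : bool := ~~ vcomplete v S && ~~ vanticomplete v S.

Definition complete X Y : bool := [forall x in X, vcomplete x Y].
Definition anticomplete X Y : bool := [forall x in X, vanticomplete x Y].

Definition component S : Prop := exists v, S = [set w | connect (adj G) v w].

(* The two parts may be empty. *)
Definition split_graph : Prop :=
  exists K S : {set V},
    [/\ K :|: S = [set: V], [disjoint K & S], clique K & stable S].
End Sets.

Definition anticomponent (V : finType) (G : sgraph V) (S X : {set V}) : Prop :=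
  exists2 Y : {set {v : V | v \in S}},
    component (compl (induced G S)) Y & X = [set val y | y in Y].

Section Substitution.
Variables (V0 W : finType) (G0 : sgraph V0) (x : V0) (H : sgraph W).
Let sadj (u v : {y : V0 | y != x} + W) : bool :=
  match u, v with
  | inl y, inl z => adj G0 (val y) (val z)
  | inr h, inr k => adj H h k
  | inl y, inr _ | inr _, inl y => adj G0 x (val y)
  end.
Fact substitution_sym : symmetric sadj.
Proof. by move=> [y|h] [z|k] //=; rewrite adj_sym. Qed.
Fact substitution_irrefl : irreflexive sadj.
Proof. by move=> [y|h] /=; rewrite adj_irrefl. Qed.
Definition substitution : sgraph ({y : V0 | y != x} + W)%type :=
  SGraph substitution_sym substitution_irrefl.
End Substitution.

Definition by_substitution (V : finType) (G : sgraph V) : Prop :=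
  exists (V0 W : finType) (G0 : sgraph V0) (x : V0) (H : sgraph W),
    [/\ iso G (substitution G0 x H),
        #|V0| < #|V|, #|W| < #|V|, P5_coP5_free G0 & P5_coP5_free H].

(* The sets A, B, C, L, T and the vertices a*, c* live in an ambient finite   *)
(* type U.  A graph on a subset S of U is represented by a graph E on U, of   *)
(* which only the restriction to S matters: the graph meant is induced E S.   *)
(* Thus, with E1 E2 : sgraph U, the two graphs of the composable pair are     *)
(* induced E1 (verts1 A B L T cs) and induced E2 (verts2 B C L T as_), and    *)
(* every condition below only involves edges inside these vertex sets.        *)
Section SplitUnification.
Variable U : finType.
Implicit Types (A B C L T : {set U}) (E : sgraph U).

Definition verts1 A B L T (cs : U) : {set U} := cs |: (A :|: B :|: L :|: T).
Definition verts2 B C L T (as_ : U) : {set U} := as_ |: (B :|: C :|: L :|: T).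

Record composable A B C L T (as_ cs : U) (E1 E2 : sgraph U) : Prop := Composable {
  cp_disjoint : pairwise (fun X Y : {set U} => [disjoint X & Y]) [:: A; B; C; L; T];
  cp_A_nonempty : A != set0;
  cp_C_nonempty : C != set0;
  cp_as_cs : as_ != cs;
  cp_as_notin : as_ \notin A :|: B :|: C :|: L :|: T;
  cp_cs_notin : cs \notin A :|: B :|: C :|: L :|: T;

  cp1_L_clique : clique E1 L;
  cp1_T_stable : stable E1 T;
  cp1_A_B : complete E1 A B;
  cp1_A_T : anticomplete E1 A T;
  cp1_A_L : exists2 a, a \in A & vcomplete E1 a L;
  cp1_cs_BL : vcomplete E1 cs (B :|: L);
  cp1_cs_AT : vanticomplete E1 cs (A :|: T);

  cp_agree : {in B :|: L :|: T &, forall x y, adj E2 x y = adj E1 x y};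

  cp2_T_C : anticomplete E2 T C;
  cp2_L_BC : complete E2 L (B :|: C);
  cp2_as_BL : vcomplete E2 as_ (B :|: L);
  cp2_as_CT : vanticomplete E2 as_ (C :|: T);
  cp2_C_B : exists2 c, c \in C & vcomplete E2 c B;
  cp2_C_mixed : forall c X, c \in C -> anticomponent E2 B X -> ~~ mixed E2 c X
}.

Section Unification.
Variables (A B C L T : {set U}) (E1 E2 : sgraph U).
Let S1 := A :|: B :|: L :|: T.
Let S2 := B :|: C :|: L :|: T.
Let uadj := [rel x y : U | [&& x \in S1, y \in S1 & adj E1 x y]
                        || [&& x \in S2, y \in S2 & adj E2 x y]].
Fact unification_sym : symmetric uadj.
Proof.
by move=> x y; rewrite /= (adj_sym E1) (adj_sym E2); congr orb;
   rewrite !andbA [X in X && _]andbC.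
Qed.
Fact unification_irrefl : irreflexive uadj.
Proof. by move=> x; rewrite /= !adj_irrefl !andbF. Qed.

Definition split_unification : sgraph {v : U | v \in A :|: B :|: C :|: L :|: T} :=
  induced (SGraph unification_sym unification_irrefl) (A :|: B :|: C :|: L :|: T).
End Unification.
End SplitUnification.

Definition by_split_unification (V : finType) (G : sgraph V) : Prop :=
  exists (U : finType) (A B C L T : {set U}) (as_ cs : U) (E1 E2 : sgraph U),
    [/\ composable A B C L T as_ cs E1 E2,
        iso G (split_unification A B C L T E1 E2),
        #|verts1 A B L T cs| < #|V| /\ #|verts2 B C L T as_| < #|V|,
        P5_coP5_free (induced E1 (verts1 A B L T cs)) &
        P5_coP5_free (induced E2 (verts2 B C L T as_))].

(* Main.v *)
(* Preservation by split unification: let W induce P5 or its complement in a split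
unification. If W meets C only in vertices complete to W :&: B, then W :&: C is
homogeneous in W, hence a single vertex, which c* can replace; so W already occurs
in G1. The same holds for A, L and a*. Otherwise W contains an induced path a b l c
through A, B, L, C, and no vertex of any of the five sets extends it to W.

Decomposition: a graph of the class containing a pentagon is a blow-up of it, up to
a homogeneous set. A graph without C5, 2K2 and C4 is split. In the remaining case
take, up to complementation, a 2K2 and an inclusion-minimal set S such that G - S
has two components with an edge. Every such component D is attached to all of S;
excluding P5, its complement and C5 shows that no vertex of D is mixed on a pair of
nonadjacent vertices of S, that some vertex of D is complete to S, and that a
vertex of S is mixed on at most one of these components. If the vertices of S
mixed on D form a clique L, this gives a split divide with A = D, B the rest of S,
C the other components with an edge, and T the isolated vertices of G - S. If S is
not a clique, the same construction works in the complement: there one can choose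
the minimal separating set inside D together with T in such a way that some
component is contained in S, and the vertices mixed on it lie in T, which is a
clique of the complement. *)

Require Import Defs.
From mathcomp Require Import all_boot.

Set Implicit Arguments.
Unset Strict Implicit.
Unset Printing Implicit Defensive.

(** * Induced copies as maps *)

Definition embeds (W V : finType) (K : sgraph W) (G : sgraph V) (f : W -> V) :=
  forall i j, adj G (f i) (f j) = adj K i j.

(** This makes every adjacency-preserving map injective, so induced copies can be handled as plain
    maps, with no injectivity condition to carry along. *)
Definition twin_free (W : finType) (K : sgraph W) :=
  forall i j, adj K i =1 adj K j -> i = j.

Lemma embeds_inj (W V : finType) (K : sgraph W) (G : sgraph V) (f : W -> V) :
  twin_free K -> embeds K G f -> injective f.
Proof. by move=> tf ef i j eq_f; apply: tf => k; rewrite -!ef eq_f. Qed.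

Lemma inj_surj_bij (T U : finType) (g : T -> U) :
  injective g -> (forall y, exists x, g x = y) -> bijective g.
Proof.
move=> gI gS; have gS' y : exists x, g x == y.
  by have [x <-] := gS y; exists x.
have gK : cancel (fun y => xchoose (gS' y)) g by move=> y; exact: eqP (xchooseP (gS' y)).
by exists (fun y => xchoose (gS' y)) => // x; apply: gI; rewrite gK.
Qed.

Lemma iso_sym (V W : finType) (G : sgraph V) (H : sgraph W) : iso G H -> iso H G.
Proof.
by move=> [f [g fK gK] fG]; exists g; [exists f | move=> x y; rewrite -fG !gK].
Qed.

Lemma free_ofP (W V : finType) (K : sgraph W) (G : sgraph V) :
  twin_free K -> free_of K G <-> forall f, ~ embeds K G f.
Proof.
move=> tf; split=> [Gfree f ef | noe [S [h [g hK gK] hG]]]; last first.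
  by apply: (noe (val \o g)) => i j; rewrite -{2}(gK i) -{2}(gK j) hG.
apply: Gfree; exists [set x in codom f]; apply: iso_sym.
have fS i : f i \in [set x in codom f] by rewrite inE codom_f.
exists (fun i => exist _ (f i) (fS i)); last by move=> i j /=; apply: ef.
apply: inj_surj_bij => [i j [] | [v vS]]; first exact: embeds_inj tf ef _ _.
have := vS; rewrite inE => /codomP[i vi].
by exists i; apply: val_inj.
Qed.

Lemma embedsVfree (W V : finType) (K : sgraph W) (G : sgraph V) :
  twin_free K -> (exists f, embeds K G f) \/ free_of K G.
Proof.
move=> tf.
case: (boolP [exists f : {ffun W -> V},
               [forall i, forall j, adj G (f i) (f j) == adj K i j]]).
  move=> /existsP[f /forallP fP]; left; exists f => i j.
  by have /forallP/(_ j)/eqP := fP i.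
move=> /existsPn nof; right; apply/(free_ofP _ tf) => f ef.
have /negP[] := nof [ffun i => f i].
by apply/forallP=> i; apply/forallP=> j; rewrite !ffunE ef.
Qed.

(** [phi] may identify vertices, since twin-freeness of [K] restores injectivity. This covers
    induced subgraphs, isomorphic graphs and graphs with duplicated vertices. *)
Lemma free_of_pullback (W V U : finType) (K : sgraph W) (G : sgraph V)
    (E : sgraph U) (phi : U -> V) :
  twin_free K -> (forall u w, adj E u w = adj G (phi u) (phi w)) ->
  free_of K G -> free_of K E.
Proof.
move=> tf phiE /(free_ofP _ tf) Gfree; apply/(free_ofP _ tf) => f ef.
by apply: (Gfree (phi \o f)) => i j /=; rewrite -phiE ef.
Qed.

Lemma embeds_compl (W V : finType) (K : sgraph W) (G : sgraph V) (f : W -> V) :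
  injective f -> embeds K (compl G) f -> embeds (compl K) G f.
Proof.
move=> fI ef i j /=; rewrite -ef /= (inj_eq fI).
by have [->|_] /= := eqVneq i j; rewrite ?adj_irrefl ?negbK.
Qed.

Lemma complK (V : finType) (G : sgraph V) : adj (compl (compl G)) =2 adj G.
Proof. by move=> x y /=; have [->|_] /= := eqVneq x y; rewrite ?adj_irrefl ?negbK. Qed.

(** * The obstructions *)

(** The index treats both forbidden graphs at once; complementation negates it. *)
Definition obstruction (b : bool) : sgraph 'I_5 := if b then compl P5 else P5.

(** Stated on [nat], so that claims about five vertices become boolean tests over [iota 0 5]. *)
Definition obstruction_adj (b : bool) (i j : nat) : bool :=
  if b then (i != j) && ~~ ((i.+1 == j) || (j.+1 == i))
  else (i.+1 == j) || (j.+1 == i).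

Lemma obstructionE b i j : adj (obstruction b) i j = obstruction_adj b i j.
Proof. by case: b. Qed.

Lemma all_ord n (P : pred nat) (i : 'I_n) : all P (iota 0 n) -> P i.
Proof. by move/allP=> allP; apply: allP; rewrite mem_iota ltn_ord. Qed.

Lemma has_ord n (P : pred nat) : has P (iota 0 n) -> exists i : 'I_n, P i.
Proof. by move=> /hasP[i]; rewrite mem_iota => lt_in Pi; exists (Ordinal lt_in). Qed.

Lemma obstruction_twin_free b : twin_free (obstruction b).
Proof.
have tf : all (fun i => all (fun j =>
    all (fun k => obstruction_adj b i k == obstruction_adj b j k) (iota 0 5)
    ==> (i == j)) (iota 0 5)) (iota 0 5) by case: b.
move=> i j eq_ij; apply/val_inj/eqP.
apply: (implyP (all_ord j (all_ord i tf))); apply/allP => k.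
rewrite mem_iota => lt_k5; have := eq_ij (Ordinal lt_k5).
by rewrite !obstructionE => ->.
Qed.

(** Primality of both obstructions: a proper homogeneous set has at most one vertex. It is what
    allows a single vertex to stand in for a whole part of a copy. *)
Lemma obstruction_prime b (P : pred 'I_5) i j k :
    (forall i j k, P i -> P j -> ~~ P k ->
       adj (obstruction b) i k = adj (obstruction b) j k) ->
  P i -> P j -> ~~ P k -> i = j.
Proof.
pose o n (lt_n : n < 5) := Ordinal lt_n.
(* Tabulating [P] as five booleans leaves a closed check over 32 subsets. *)
pose p := nth false [:: P (o 0 isT); P (o 1 isT); P (o 2 isT); P (o 3 isT);
                        P (o 4 isT)].
have PE l : P l = p l.
  by case: l => [[|[|[|[|[|//]]]]] lt_l] /=; congr P; apply: val_inj.
have prime_p :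
    all (fun i => all (fun j => all (fun k => [&& p i, p j & ~~ p k] ==>
      (obstruction_adj b i k == obstruction_adj b j k))
      (iota 0 5)) (iota 0 5)) (iota 0 5) ==>
    all (fun i => all (fun j => all (fun k => [&& p i, p j & ~~ p k] ==>
      (i == j)) (iota 0 5)) (iota 0 5)) (iota 0 5).
  rewrite /p; move: (P _) (P _) (P _) (P _) (P _).
  by case: b {p PE}; do 5 case; vm_compute.
move=> homP Pi Pj Pk; apply/val_inj/eqP; move/implyP: prime_p => prime_p.
apply: (implyP (all_ord k (all_ord j (all_ord i (prime_p _)))));
  last by rewrite -!PE Pi Pj Pk.
apply/allP => i'; rewrite mem_iota => lt_i.
apply/allP => j'; rewrite mem_iota => lt_j.
apply/allP => k'; rewrite mem_iota => lt_k.
have := homP (o i' lt_i) (o j' lt_j) (o k' lt_k).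
rewrite !PE !obstructionE /= => homp.
by apply/implyP=> /and3P[pi pj pk]; rewrite homp.
Qed.

(* The fifth vertex continues the path a b l c in P5, and continues the path
   b c a l of the complement in the complement of P5. *)
Lemma obstruction_P4_extension x (a b l c : 'I_5) :
    let K := adj (obstruction x) in
    [&& K a b, K b l, K l c, ~~ K a l, ~~ K a c & ~~ K b c] ->
  exists v, [|| [&& K v a, ~~ K v b, ~~ K v l & ~~ K v c],
                [&& ~~ K v a, ~~ K v b, ~~ K v l & K v c],
                [&& K v a, ~~ K v b, K v l & K v c] |
                [&& K v a, K v b, ~~ K v l & K v c]].
Proof.
move=> K; rewrite /K !obstructionE.
pose k := obstruction_adj x.
have ext : all (fun a => all (fun b => all (fun l => all (fun c =>
    [&& k a b, k b l, k l c, ~~ k a l, ~~ k a c & ~~ k b c] ==>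
    has (fun v => [|| [&& k v a, ~~ k v b, ~~ k v l & ~~ k v c],
                      [&& ~~ k v a, ~~ k v b, ~~ k v l & k v c],
                      [&& k v a, ~~ k v b, k v l & k v c] |
                      [&& k v a, k v b, ~~ k v l & k v c]]) (iota 0 5))
    (iota 0 5)) (iota 0 5)) (iota 0 5)) (iota 0 5).
  by rewrite /k; case: (x); vm_compute.
move/(implyP (all_ord c (all_ord l (all_ord b (all_ord a ext)))))/has_ord.
by case=> v vP; exists v; rewrite !obstructionE.
Qed.

Lemma P5_coP5_freeP (V : finType) (G : sgraph V) :
  P5_coP5_free G <-> forall b, free_of (obstruction b) G.
Proof. by split=> [[? ?] []|fr] //; split; [apply: (fr false)|apply: (fr true)]. Qed.

Lemma P5_coP5_free_pullback (V U : finType) (G : sgraph V) (E : sgraph U)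
    (phi : U -> V) :
  (forall u w, adj E u w = adj G (phi u) (phi w)) ->
  P5_coP5_free G -> P5_coP5_free E.
Proof.
move=> phiE /P5_coP5_freeP Gfree; apply/P5_coP5_freeP => b.
exact: free_of_pullback (@obstruction_twin_free b) phiE (Gfree b).
Qed.

Lemma P5_coP5_free_induced (V : finType) (G : sgraph V) (S : {set V}) :
  P5_coP5_free G -> P5_coP5_free (induced G S).
Proof. exact: P5_coP5_free_pullback. Qed.

Lemma P5_coP5_free_iso (V W : finType) (G : sgraph V) (H : sgraph W) :
  iso G H -> P5_coP5_free H -> P5_coP5_free G.
Proof. by case=> f _ fG; apply: (P5_coP5_free_pullback (phi := f)). Qed.

Lemma P5_coP5_free_compl (V : finType) (G : sgraph V) :
  P5_coP5_free G -> P5_coP5_free (compl G).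
Proof.
move=> /P5_coP5_freeP Gfree; apply/P5_coP5_freeP => b.
apply/(free_ofP _ (@obstruction_twin_free b)) => f ef.
have /(free_ofP _ (@obstruction_twin_free _))/(_ f)[] := Gfree (~~ b) => i j.
rewrite (embeds_compl (embeds_inj (@obstruction_twin_free b) ef) ef).
by case: b {ef} => //; apply: complK.
Qed.

Lemma P5_coP5_free_complK (V : finType) (G : sgraph V) :
  P5_coP5_free (compl G) -> P5_coP5_free G.
Proof.
move=> /P5_coP5_free_compl; apply: (P5_coP5_free_pullback (phi := id)) => u w.
by rewrite complK.
Qed.

Lemma C5_twin_free : twin_free C5.
Proof.
move=> i j eq_ij; apply/val_inj/eqP.
move: (eq_ij (ordS i)) (eq_ij (ord_pred i)) => {eq_ij}.
by case: i j => [[|[|[|[|[|//]]]]] ?] [[|[|[|[|[|//]]]]] ?].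
Qed.

Lemma C5_free_compl (V : finType) (G : sgraph V) :
  free_of C5 G -> free_of C5 (compl G).
Proof.
move=> /(free_ofP _ C5_twin_free) Gfree.
apply/(free_ofP _ C5_twin_free) => f ef.
have efc := embeds_compl (embeds_inj C5_twin_free ef) ef.
(* Doubling modulo 5 maps the pentagon onto its complement. *)
have lt5 (i : 'I_5) : 2 * i %% 5 < 5 by rewrite ltn_mod.
apply: (Gfree (fun i => f (Ordinal (lt5 i)))) => i j; rewrite efc.
by case: i j => [[|[|[|[|[|//]]]]] ?] [[|[|[|[|[|//]]]]] ?].
Qed.
(** * The operations preserve the class *)

Lemma split_graph_free (V : finType) (G : sgraph V) :
  split_graph G -> P5_coP5_free G.
Proof.
move=> [K [S [KS _ Kcl Sst]]]; apply/P5_coP5_freeP => x.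
have notK v : v \notin K -> v \in S.
  by have : v \in K :|: S; [rewrite KS | rewrite inE => /orP[->|]].
apply/(free_ofP _ (@obstruction_twin_free x)) => f ef.
have fI := embeds_inj (@obstruction_twin_free x) ef.
pose k := obstruction_adj x; pose o n (lt_n : n < 5) := Ordinal lt_n.
pose p := nth false [:: f (o 0 isT) \in K; f (o 1 isT) \in K; f (o 2 isT) \in K;
                        f (o 3 isT) \in K; f (o 4 isT) \in K].
have pE (i : 'I_5) : p i = (f i \in K).
  by case: i => [[|[|[|[|[|//]]]]] lt_i] /=; congr (f _ \in K); apply: val_inj.
have pK : all (fun i => all (fun j =>
    (p i && p j && (i != j) ==> k i j) && (~~ p i && ~~ p j ==> ~~ k i j))
    (iota 0 5)) (iota 0 5).
  apply/allP => i; rewrite mem_iota => lt_i; apply/allP => j.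
  rewrite mem_iota => lt_j; have := (pE (o i lt_i), pE (o j lt_j)).
  rewrite /= => -[-> ->]; have := ef (o i lt_i) (o j lt_j).
  rewrite obstructionE /= -/k => <-; apply/andP; split; apply/implyP.
    by move=> /andP[/andP[iK jK] neq_ij]; apply: Kcl; rewrite // (inj_eq fI).
  by case/andP=> iK jK; apply: Sst; apply: notK.
(* Neither obstruction is split: each of the 32 traces of [K] on it is refuted by computation. *)
move: pK; rewrite /k /p; move: (_ \in K) (_ \in K) (_ \in K) (_ \in K) (_ \in K).
by case: (x); do 5 case; vm_compute.
Qed.

(** A copy would be bijective and the obstruction 2-regular, but an end of the path has degree 1,
    and degree 3 in the complement. *)
Lemma C5_free_of_obstructions : P5_coP5_free C5.
Proof.
apply/P5_coP5_freeP => b; apply/(free_ofP _ (@obstruction_twin_free b)) => f ef.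
have fI := embeds_inj (@obstruction_twin_free b) ef.
have [g fK gK] : bijective f by apply: injF_bij.
have deg2 i : #|[set j | adj (obstruction b) i j]| = 2.
  transitivity #|f @: [set j | adj (obstruction b) i j]|.
    by rewrite card_imset.
  transitivity #|[set ordS (f i); ord_pred (f i)]|.
    apply: eq_card => j; rewrite !inE -{1}(gK j) mem_imset // inE -ef gK.
    by case: (f i) j => [[|[|[|[|[|//]]]]] ?] [[|[|[|[|[|//]]]]] ?].
  by rewrite cards2; case: (f i) => [[|[|[|[|[|//]]]]] ?].
pose i0 : 'I_5 := ord0; pose i1 : 'I_5 := ordS i0.
case: b deg2 {ef fI fK gK} => deg2.
  have := deg2 i0; suff -> : [set j | adj (obstruction true) i0 j] = ~: [set i0; i1].
    by rewrite cardsCs setCK cards2 card_ord.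
  by apply/setP=> -[[|[|[|[|[|//]]]]] ?]; rewrite !inE.
have := deg2 i0; suff -> : [set j | adj (obstruction false) i0 j] = [set i1].
  by rewrite cards1.
by apply/setP=> -[[|[|[|[|[|//]]]]] ?]; rewrite !inE.
Qed.

(** The part of a copy inside [H] is homogeneous. By primality either it is the whole copy, which
    then lives in [H], or it has at most one vertex, which [x] replaces. *)
Lemma substitution_free (V0 W : finType) (G0 : sgraph V0) (x : V0) (H : sgraph W) :
  P5_coP5_free G0 -> P5_coP5_free H -> P5_coP5_free (substitution G0 x H).
Proof.
move=> /P5_coP5_freeP free0 /P5_coP5_freeP freeH; apply/P5_coP5_freeP => b.
have tf := @obstruction_twin_free b.
apply/(free_ofP _ tf) => f ef.
pose P i := if f i is inr _ then true else false.
have homP i j k : P i -> P j -> ~~ P k ->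
    adj (obstruction b) i k = adj (obstruction b) j k.
  by rewrite /P -!ef; case: (f i) (f j) (f k) => [?|?] [?|?] [?|?].
case: (boolP [forall i, P i]) => [/forallP allP|/forallPn[k Pk]].
  have /(free_ofP _ tf) := freeH b.
  have : P ord0 by [].
  rewrite /P; case: (f ord0) => // h0 _.
  case/(_ (fun i => if f i is inr h then h else h0)) => i j.
  by have := (allP i, allP j); rewrite /P -ef; case: (f i) (f j) => [?|?] [?|?] [].
have /(free_ofP _ tf) := free0 b.
case/(_ (fun i => if f i is inl y then val y else x)) => i j.
have := @obstruction_prime b P i j k homP; rewrite /P -ef.
case fi: (f i) => [y|h]; case fj: (f j) => [z|g] //=; first by rewrite adj_sym.
move/(_ isT isT Pk) => eq_ij; move: fj.
by rewrite -eq_ij fi => -[->]; rewrite !adj_irrefl.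
Qed.

Lemma by_substitution_free (V : finType) (G : sgraph V) :
  by_substitution G -> P5_coP5_free G.
Proof.
move=> [V0 [W [G0 [x [H [isoG _ _ free0 freeH]]]]]].
exact: P5_coP5_free_iso isoG (substitution_free _ free0 freeH).
Qed.

Lemma free_of_induced (W V : finType) (K : sgraph W) (G : sgraph V) (S : {set V})
    (f : W -> V) :
  twin_free K -> free_of K (induced G S) -> (forall i, f i \in S) -> ~ embeds K G f.
Proof.
move=> tf /(free_ofP _ tf) noe fS ef.
by apply: (noe (fun i => exist _ (f i) (fS i))) => i j; apply: ef.
Qed.

Lemma completeP (V : finType) (E : sgraph V) (X Y : {set V}) x y :
  complete E X Y -> x \in X -> y \in Y -> adj E x y.
Proof. by move=> /forall_inP XY xX; move: y; apply/forall_inP/XY. Qed.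

Lemma anticompleteP (V : finType) (E : sgraph V) (X Y : {set V}) x y :
  anticomplete E X Y -> x \in X -> y \in Y -> adj E x y = false.
Proof. by move=> /forall_inP XY xX yY; apply/negbTE; move: y yY; apply/forall_inP/XY. Qed.

Lemma vcompleteP (V : finType) (E : sgraph V) (Y : {set V}) x y :
  vcomplete E x Y -> y \in Y -> adj E x y.
Proof. by move=> /forall_inP; apply. Qed.

Lemma vanticompleteP (V : finType) (E : sgraph V) (Y : {set V}) x y :
  vanticomplete E x Y -> y \in Y -> adj E x y = false.
Proof. by move=> /forall_inP xY yY; apply/negbTE/xY. Qed.

(** * Split unification preserves the class *)

Section SplitUnificationFree.
Variables (U : finType) (A B C L T : {set U}) (as_ cs : U) (E1 E2 : sgraph U).
Hypothesis pair : composable A B C L T as_ cs E1 E2.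
Hypothesis free1 : P5_coP5_free (induced E1 (verts1 A B L T cs)).
Hypothesis free2 : P5_coP5_free (induced E2 (verts2 B C L T as_)).

(** Destructing it rewrites all five membership tests at once. *)
Variant part (u : U) : bool -> bool -> bool -> bool -> bool -> Prop :=
  | PartA of u \in A : part u true false false false false
  | PartB of u \in B : part u false true false false false
  | PartC of u \in C : part u false false true false false
  | PartL of u \in L : part u false false false true false
  | PartT of u \in T : part u false false false false true.

Lemma partP u : u \in A :|: B :|: C :|: L :|: T ->
  part u (u \in A) (u \in B) (u \in C) (u \in L) (u \in T).
Proof.
have := cp_disjoint pair; rewrite /= !andbT.
case/and4P=> /and4P[AB AC AL AT] /and3P[BC BL BT] /andP[CL CT] LT.
rewrite !inE => /orP[/orP[/orP[/orP[]|]|]|] uX; rewrite uX.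
- by rewrite (disjointFr AB) ?(disjointFr AC) ?(disjointFr AL) ?(disjointFr AT) //;
    constructor.
- by rewrite (disjointFl AB) ?(disjointFr BC) ?(disjointFr BL) ?(disjointFr BT) //;
    constructor.
- by rewrite (disjointFl AC) ?(disjointFl BC) ?(disjointFr CL) ?(disjointFr CT) //;
    constructor.
- by rewrite (disjointFl AL) ?(disjointFl BL) ?(disjointFl CL) ?(disjointFr LT) //;
    constructor.
- by rewrite (disjointFl AT) ?(disjointFl BT) ?(disjointFl CT) ?(disjointFl LT) //;
    constructor.
Qed.

Lemma split_unification_free :
  P5_coP5_free (split_unification A B C L T E1 E2).
Proof.
apply/P5_coP5_freeP => x.
have tf := @obstruction_twin_free x.
have /P5_coP5_freeP/(_ x) free1x := free1.
have /P5_coP5_freeP/(_ x) free2x := free2.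
apply/(free_ofP _ tf) => f0 ef0.
pose f i := val (f0 i).
have fU i : f i \in A :|: B :|: C :|: L :|: T by apply: valP.
pose K := adj (obstruction x).
have Ksym i j : K i j = K j i by apply: adj_sym.
have KE i j : K i j = [&& f i \in A :|: B :|: L :|: T, f j \in A :|: B :|: L :|: T
                        & adj E1 (f i) (f j)]
                   || [&& f i \in B :|: C :|: L :|: T, f j \in B :|: C :|: L :|: T
                        & adj E2 (f i) (f j)].
  by rewrite /K -ef0.
have agree i j : f i \in B :|: L :|: T -> f j \in B :|: L :|: T ->
    adj E2 (f i) (f j) = adj E1 (f i) (f j).
  exact: (cp_agree pair).
have K1 i j : f i \notin C -> f j \notin C -> K i j = adj E1 (f i) (f j).
  rewrite KE; have := agree i j; rewrite !inE.
  case: (partP (fU i)) => // _; case: (partP (fU j)) => //= _;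
    by do ?[move=> -> //]; rewrite ?orbF ?orbb.
have K2 i j : f i \notin A -> f j \notin A -> K i j = adj E2 (f i) (f j).
  rewrite KE; have := agree i j; rewrite !inE.
  case: (partP (fU i)) => // _; case: (partP (fU j)) => //= _;
    by do ?[move=> -> //]; rewrite ?orbF ?orbb.
have KAC i j : f i \in A -> f j \in C -> K i j = false.
  rewrite KE !inE; case: (partP (fU i)) => // _; by case: (partP (fU j)) => //= _.
have KAB i j : f i \in A -> f j \in B -> K i j = true.
  move=> iA jB; rewrite K1 ?(completeP (cp1_A_B pair) iA jB) //;
  [by case: (partP (fU i)) iA | by case: (partP (fU j)) jB].
have KAT i j : f i \in A -> f j \in T -> K i j = false.
  move=> iA jT; rewrite K1 ?(anticompleteP (cp1_A_T pair) iA jT) //;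
  [by case: (partP (fU i)) iA | by case: (partP (fU j)) jT].
have KTC i j : f i \in T -> f j \in C -> K i j = false.
  move=> iT jC; rewrite K2 ?(anticompleteP (cp2_T_C pair) iT jC) //;
  [by case: (partP (fU i)) iT | by case: (partP (fU j)) jC].
have KLBC i j : f i \in L -> (f j \in B) || (f j \in C) -> K i j = true.
  move=> iL jBC; rewrite K2 ?(completeP (cp2_L_BC pair) iL) ?inE //;
  [by case: (partP (fU i)) iL | by case: (partP (fU j)) jBC].
have KLL i j : f i \in L -> f j \in L -> i != j -> K i j = true.
  move=> iL jL neq_ij; rewrite K1 ?(cp1_L_clique pair iL jL) //.
  - by rewrite (inj_eq (inj_comp val_inj (embeds_inj tf ef0))).
  - by case: (partP (fU i)) iL.
  - by case: (partP (fU j)) jL.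
(* A copy that misses [A] lies in the second graph of the pair, one that misses [C] in the first. *)
have [iA fiA] : exists i, f i \in A.
  apply/existsP; case: (boolP [exists i, _]) => // /existsPn notA.
  case: (free_of_induced (f := f) tf free2x) => [i|i j]; last by rewrite -K2.
  by rewrite !inE; case: (partP (fU i)) (notA i) => // ? _; rewrite ?orbT.
have [iC fiC] : exists i, f i \in C.
  apply/existsP; case: (boolP [exists i, _]) => // /existsPn notC.
  case: (free_of_induced (f := f) tf free1x) => [i|i j]; last by rewrite -K1.
  by rewrite !inE; case: (partP (fU i)) (notC i) => // ? _; rewrite ?orbT.
(* Otherwise the copy's vertices in [C] form a homogeneous set, hence a single vertex, and putting
   [cs] in its place gives a copy in the first graph. *)
have [c [b [fc fb cb]]] : exists c b, [/\ f c \in C, f b \in B & ~~ K c b].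
  case: (boolP [exists c, [exists b, [&& f c \in C, f b \in B & ~~ K c b]]]).
    by move=> /existsP[c /existsP[b /and3P[]]]; exists c, b.
  move=> /existsPn CBn.
  have KCB c b : f c \in C -> f b \in B -> K c b = true.
    move=> fc fb; apply/negPn/negP => cb.
    by have /existsPn/(_ b) := CBn c; rewrite fc fb cb.
  have KC i j : f i \in C -> f j \notin C -> K i j = (f j \in B) || (f j \in L).
    move=> fi; case: (partP (fU j)) => // fj _; rewrite /=.
    - by rewrite Ksym KAC.
    - exact: KCB.
    - by rewrite Ksym KLBC ?fi ?orbT.
    - by rewrite Ksym KTC.
  have Ceq i j : f i \in C -> f j \in C -> i = j.
    move=> fi fj.
    apply: (@obstruction_prime x (fun i => f i \in C) i j iA) => // [i' j' k fi' fj' fk|].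
      by rewrite -/K !KC.
    by case: (partP (fU iA)) fiA.
  pose g i := if f i \in C then cs else f i.
  case: (free_of_induced (f := g) tf free1x) => [i|i j].
    rewrite /g; case: ifPn => [_|]; rewrite !inE ?eqxx //.
    by case: (partP (fU i)); rewrite ?orbT.
  have csE k : f k \notin C -> adj E1 cs (f k) = (f k \in B) || (f k \in L).
    case: (partP (fU k)) => //= fk _.
    - by apply: (vanticompleteP (cp1_cs_AT pair)); rewrite !inE fk.
    - by apply: (vcompleteP (cp1_cs_BL pair)); rewrite !inE fk.
    - by apply: (vcompleteP (cp1_cs_BL pair)); rewrite !inE fk orbT.
    - by apply: (vanticompleteP (cp1_cs_AT pair)); rewrite !inE fk orbT.
  rewrite -/K /g; case: ifPn => fi; case: ifPn => fj.
  - by rewrite (Ceq i j) // adj_irrefl /K adj_irrefl.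
  - by rewrite csE // KC.
  - by rewrite adj_sym csE // Ksym KC.
  - by rewrite K1.
(* The same argument with [A], [L] and [as_] in the second graph. *)
have [a [l [fa fl al]]] : exists a l, [/\ f a \in A, f l \in L & ~~ K a l].
  case: (boolP [exists a, [exists l, [&& f a \in A, f l \in L & ~~ K a l]]]).
    by move=> /existsP[a /existsP[l /and3P[]]]; exists a, l.
  move=> /existsPn ALn.
  have KAL a l : f a \in A -> f l \in L -> K a l = true.
    move=> fa fl; apply/negPn/negP => al.
    by have /existsPn/(_ l) := ALn a; rewrite fa fl al.
  have KA i j : f i \in A -> f j \notin A -> K i j = (f j \in B) || (f j \in L).
    move=> fi; case: (partP (fU j)) => // fj _; rewrite /=.
    - exact: KAB.
    - exact: KAC.
    - exact: KAL.
    - exact: KAT.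
  have Aeq i j : f i \in A -> f j \in A -> i = j.
    move=> fi fj.
    apply: (@obstruction_prime x (fun i => f i \in A) i j iC) => // [i' j' k fi' fj' fk|].
      by rewrite -/K !KA.
    by case: (partP (fU iC)) fiC.
  pose g i := if f i \in A then as_ else f i.
  case: (free_of_induced (f := g) tf free2x) => [i|i j].
    rewrite /g; case: ifPn => [_|]; rewrite !inE ?eqxx //.
    by case: (partP (fU i)); rewrite ?orbT.
  have asE k : f k \notin A -> adj E2 as_ (f k) = (f k \in B) || (f k \in L).
    case: (partP (fU k)) => //= fk _.
    - by apply: (vcompleteP (cp2_as_BL pair)); rewrite !inE fk.
    - by apply: (vanticompleteP (cp2_as_CT pair)); rewrite !inE fk.
    - by apply: (vcompleteP (cp2_as_BL pair)); rewrite !inE fk orbT.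
    - by apply: (vanticompleteP (cp2_as_CT pair)); rewrite !inE fk orbT.
  rewrite -/K /g; case: ifPn => fi; case: ifPn => fj.
  - by rewrite (Aeq i j) // adj_irrefl /K adj_irrefl.
  - by rewrite asE // KA.
  - by rewrite adj_sym asE // Ksym KA.
  - by rewrite K2.
have Kac := KAC a c fa fc; have Kab := KAB a b fa fb.
have Klb : K l b by rewrite KLBC ?fb.
have Klc : K l c by rewrite KLBC ?fc ?orbT.
case: (@obstruction_P4_extension x a b l c).
  by rewrite -/K Kab (Ksym b l) Klb Klc al Kac (Ksym b c) cb.
move=> v; rewrite -/K; case: (partP (fU v)) => fv.
- by rewrite (KAB v b) // (KAC v c) // !andbF.
(* In [B], [v] sees [a] and [l], so the only remaining pattern has [v] adjacent to [c] and not to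
   [b]. Then [v] and [b] lie in one anticomponent of [B], on which [c] is mixed. *)
- have vB : f v \notin A by case: (partP (fU v)) fv.
  have cA : f c \notin A by case: (partP (fU c)) fc.
  have bA : f b \notin A by case: (partP (fU b)) fb.
  rewrite (Ksym v a) (KAB a v) // (Ksym v l) (KLBC l v) ?fv //= !andbF /= ?orbF.
  case/andP=> vb vc.
  pose v' : {u | u \in B} := exist _ (f v) fv.
  pose b' : {u | u \in B} := exist _ (f b) fb.
  pose X := [set val w | w in [set w | connect (adj (compl (induced E2 B))) v' w]].
  have /negP[] : ~~ mixed E2 (f c) X.
    by apply: (cp2_C_mixed pair) => //; eexists; [exists v' | ].
  have v'X : f v \in X by apply/imsetP; exists v'; rewrite // inE connect0.
  have b'X : f b \in X.
    apply/imsetP; exists b'; rewrite // inE connect1 //= -K2 // vb andbT.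
    apply: contraNneq cb => /(congr1 val) /= eq_vb.
    by rewrite K2 // -eq_vb -K2 // Ksym.
  apply/andP; split; apply/forall_inP.
    by move/(_ _ b'X); rewrite -K2 // (negPf cb).
  by move/(_ _ v'X); rewrite -K2 // Ksym vc.
- by rewrite (Ksym v a) (KAC a v) // (Ksym v l) (KLBC l v) ?fv ?orbT //= !andbF.
- rewrite (KLBC v b) ?fb //= (KLBC v c) ?fc ?orbT //= ?andbT !andbF /=.
  have [->|neq_vl] := eqVneq v l; first by rewrite Ksym (negPf al).
  by rewrite (KLL v l) // andbF.
- by rewrite (Ksym v a) (KAT a v) // (KTC v c) // !andbF.
Qed.

End SplitUnificationFree.

Lemma by_split_unification_free (V : finType) (G : sgraph V) :
  by_split_unification G -> P5_coP5_free G.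
Proof.
move=> [U [A [B [C [L [T [as_ [cs [E1 [E2 [pair isoG _ free1 free2]]]]]]]]]]].
exact: P5_coP5_free_iso isoG (split_unification_free pair free1 free2).
Qed.

(** * Homogeneous sets and pentagons *)

(** [G] arises by substituting [G[X]] for [x0] in the subgraph on [x0] and the complement of [X].
    The two conditions on the size of [X] make both graphs smaller than [G]. *)
Lemma homogeneous_by_substitution (V : finType) (G : sgraph V) (X : {set V}) :
    P5_coP5_free G -> 1 < #|X| -> X != setT ->
    (forall x y z, x \in X -> y \in X -> z \notin X -> adj G x z = adj G y z) ->
  by_substitution G.
Proof.
move=> Gfree X_gt1 XnT homX.
have /card_gt0P[x0 x0X] : 0 < #|X| by apply: ltnW.
pose S0 := x0 |: ~: X.
have x0S0 : x0 \in S0 by rewrite !inE eqxx.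
have XC_card : #|X| + #|~: X| = #|V| by rewrite cardsC.
exists {v | v \in S0}, {v | v \in X}, (induced G S0), (exist _ x0 x0S0), (induced G X).
split; try exact: P5_coP5_free_induced.
- apply: iso_sym.
  have notX (y : {y : {v | v \in S0} | y != exist _ x0 x0S0}) : val (val y) \notin X.
    case: y => [[y yS0] /= y_neq]; move: y_neq; rewrite -val_eqE /=.
    by case/setU1P: yS0 => [->|]; rewrite ?eqxx // inE.
  pose g (u : {y : {v | v \in S0} | y != exist _ x0 x0S0} + {v | v \in X}) :=
    match u with inl y => val (val y) | inr h => val h end.
  exists g.
    apply: inj_surj_bij => [[y|h] [z|k] /= eq_g | v].
    - by congr inl; do 2 apply: val_inj.
    - by move: (notX y) (valP k) => /=; rewrite eq_g => /negP.
    - by move: (notX z) (valP h) => /=; rewrite eq_g => /negP.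
    - by congr inr; apply: val_inj.
    have [vX|vX] := boolP (v \in X); first by exists (inr (exist _ v vX)).
    have vS0 : v \in S0 by rewrite !inE vX orbT.
    have v_neq : (exist _ v vS0 : {v | v \in S0}) != exist _ x0 x0S0.
      by rewrite -val_eqE /=; apply: contraNneq vX => ->.
    by exists (inl (exist _ (exist _ v vS0) v_neq)).
  move=> [y|h] [z|k] //=.
    by rewrite adj_sym; apply: homX (valP k) x0X (notX y).
  exact: homX (valP h) x0X (notX z).
- rewrite card_sig (eq_card (B := mem S0)) // cardsU1 inE x0X /= -XC_card.
  by rewrite ltn_add2r.
- rewrite card_sig (eq_card (B := mem X)) // -XC_card -[X in X < _]addn0 ltn_add2l.
  by rewrite card_gt0; apply: contra XnT => /eqP XC0; rewrite -[X]setCK XC0 setC0.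
Qed.

Ltac adjacency := solve [assumption | rewrite adj_sym; assumption].

(** * Forbidden subgraphs as vertex tuples *)

Section Obstructions.
Variables (V : finType) (G : sgraph V).

Lemma no_P5 p q r s t : free_of P5 G ->
  adj G p q -> adj G q r -> adj G r s -> adj G s t ->
  ~~ adj G p r -> ~~ adj G p s -> ~~ adj G p t ->
  ~~ adj G q s -> ~~ adj G q t -> ~~ adj G r t -> False.
Proof.
move=> /(free_ofP _ (@obstruction_twin_free false)).
move/(_ (fun i : 'I_5 => nth p [:: p; q; r; s; t] i)) => noe.
move=> pq qr rs st pr ps pt qs qt rt; apply: noe => i j.
rewrite obstructionE.
case: i j => [[|[|[|[|[|//]]]]] ?] [[|[|[|[|[|//]]]]] ?];
  rewrite /= ?adj_irrefl //; do ?[by apply/negbTE; adjacency];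
  by rewrite ?pq ?qr ?rs ?st // adj_sym.
Qed.

(** The complement of [P5] is a square [p q r s] with a roof [t] over [p q]. Its nonedges form the
    path [p r t s q], whence the order of the list. *)
Lemma no_house p q r s t : free_of (compl P5) G ->
  adj G p q -> adj G q r -> adj G r s -> adj G s p ->
  ~~ adj G p r -> ~~ adj G q s ->
  adj G t p -> adj G t q -> ~~ adj G t r -> ~~ adj G t s -> False.
Proof.
move=> /(free_ofP _ (@obstruction_twin_free true)).
move/(_ (fun i : 'I_5 => nth p [:: p; r; t; s; q] i)) => noe.
move=> pq qr rs sp pr qs tp tq tr ts; apply: noe => i j.
rewrite obstructionE.
case: i j => [[|[|[|[|[|//]]]]] ?] [[|[|[|[|[|//]]]]] ?];
  rewrite /= ?adj_irrefl //; do ?[by apply/negbTE; adjacency];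
  by rewrite ?pq ?qr ?rs ?sp ?tp ?tq // adj_sym.
Qed.

Definition pentagon p q r s t :=
  [&& adj G p q, adj G q r, adj G r s, adj G s t & adj G t p] &&
  [&& ~~ adj G p r, ~~ adj G q s, ~~ adj G r t, ~~ adj G s p & ~~ adj G t q].

Lemma embeds_C5P : (exists f, embeds C5 G f) <-> exists p q r s t, pentagon p q r s t.
Proof.
split=> [[f ef]|[p [q [r [s [t /andP[/and5P[pq qr rs st tp] /and5P[pr qs rt sp tq]]]]]]]].
  pose o n (lt_n : n < 5) := Ordinal lt_n.
  exists (f (o 0 isT)), (f (o 1 isT)), (f (o 2 isT)), (f (o 3 isT)), (f (o 4 isT)).
  by rewrite /pentagon !ef.
exists (fun i : 'I_5 => nth p [:: p; q; r; s; t] i) => i j.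
case: i j => [[|[|[|[|[|//]]]]] ?] [[|[|[|[|[|//]]]]] ?];
  rewrite /= ?adj_irrefl //; do ?[by apply/negbTE; adjacency];
  by rewrite ?pq ?qr ?rs ?st ?tp // adj_sym.
Qed.

Lemma no_C5 p q r s t : free_of C5 G ->
  adj G p q -> adj G q r -> adj G r s -> adj G s t -> adj G t p ->
  ~~ adj G p r -> ~~ adj G q s -> ~~ adj G r t -> ~~ adj G s p -> ~~ adj G t q ->
  False.
Proof.
move=> /(free_ofP _ C5_twin_free) noe pq qr rs st tp pr qs rt sp tq.
have /embeds_C5P[f /noe//] : exists p q r s t, pentagon p q r s t.
by exists p, q, r, s, t; apply/andP; split; apply/and5P.
Qed.

End Obstructions.

(** * Graphs containing a pentagon *)

Section Pentagon.
Variables (V : finType) (G : sgraph V).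
Hypothesis Gfree : P5_coP5_free G.

(* v attaches to the pentagon like p, adjacency to p itself being left open. *)
Definition twin v (p q r s t : V) :=
  [&& adj G v q, adj G v t, ~~ adj G v r & ~~ adj G v s].

Lemma pentagon_rot p q r s t : pentagon G p q r s t -> pentagon G q r s t p.
Proof.
case/andP=> /and5P[pq qr rs st tp] /and5P[pr qs rt sp tq].
by apply/andP; split; apply/and5P; split.
Qed.

Lemma pentagon_rev p q r s t : pentagon G p q r s t -> pentagon G p t s r q.
Proof.
case/andP=> /and5P[pq qr rs st tp] /and5P[pr qs rt sp tq].
by apply/andP; split; apply/and5P; split; adjacency.
Qed.

Lemma pentagon_twin v p q r s t :
  pentagon G p q r s t -> twin v p q r s t -> pentagon G v q r s t.
Proof.
case/andP=> /and5P[pq qr rs st tp] /and5P[pr qs rt sp tq] /and4P[vq vt vr vs].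
by apply/andP; split; apply/and5P; split; adjacency.
Qed.

(** Otherwise [v p q r s] is an induced [P5]. *)
Lemma pentagon_nbr v p q r s t : pentagon G p q r s t ->
  adj G v p -> [|| adj G v q, adj G v r | adj G v s].
Proof.
case/andP=> /and5P[pq qr rs st tp] /and5P[pr qs rt sp tq] vp.
apply/negPn/negP; rewrite !negb_or => /and3P[vq vr vs].
by apply: (@no_P5 _ G v p q r s) => //; [case: Gfree | adjacency].
Qed.

(** Otherwise the square [v q p t] with roof [r] over [v q] is a house. *)
Lemma pentagon_non_nbr v p q r s t : pentagon G p q r s t ->
  ~~ adj G v p -> [|| ~~ adj G v q, ~~ adj G v r | ~~ adj G v t].
Proof.
case/andP=> /and5P[pq qr rs st tp] /and5P[pr qs rt sp tq] vp.
apply/negPn/negP; rewrite !negb_or !negbK => /and3P[vq vr vt].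
by apply: (@no_house _ G v q p t r) => //; try adjacency; case: Gfree.
Qed.

(** Applied to the five rotations and their reflections, the two preceding constraints leave only
    these of the 32 patterns. *)
Lemma pentagon_attachment v p q r s t : pentagon G p q r s t ->
  [|| [&& ~~ adj G v p, ~~ adj G v q, ~~ adj G v r, ~~ adj G v s & ~~ adj G v t],
      [&& adj G v p, adj G v q, adj G v r, adj G v s & adj G v t],
      twin v p q r s t, twin v q r s t p, twin v r s t p q, twin v s t p q r
    | twin v t p q r s].
Proof.
move=> C0; have C1 := pentagon_rot C0; have C2 := pentagon_rot C1.
have C3 := pentagon_rot C2; have C4 := pentagon_rot C3.
move: (pentagon_nbr (v := v) C0) (pentagon_non_nbr (v := v) C0)
  (pentagon_nbr (v := v) (pentagon_rev C0)) (pentagon_non_nbr (v := v) (pentagon_rev C0)).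
move: (pentagon_nbr (v := v) C1) (pentagon_non_nbr (v := v) C1)
  (pentagon_nbr (v := v) (pentagon_rev C1)) (pentagon_non_nbr (v := v) (pentagon_rev C1)).
move: (pentagon_nbr (v := v) C2) (pentagon_non_nbr (v := v) C2)
  (pentagon_nbr (v := v) (pentagon_rev C2)) (pentagon_non_nbr (v := v) (pentagon_rev C2)).
move: (pentagon_nbr (v := v) C3) (pentagon_non_nbr (v := v) C3)
  (pentagon_nbr (v := v) (pentagon_rev C3)) (pentagon_non_nbr (v := v) (pentagon_rev C3)).
move: (pentagon_nbr (v := v) C4) (pentagon_non_nbr (v := v) C4)
  (pentagon_nbr (v := v) (pentagon_rev C4)) (pentagon_non_nbr (v := v) (pentagon_rev C4)).
rewrite /twin; move: (adj G v p) (adj G v q) (adj G v r) (adj G v s) (adj G v t).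
by do 5 case; do ?[by []]; do ?[move=> /(_ isT) // | move=> _].
Qed.

(** In the pentagon with [x] in place of [p], [y] sees [r] but neither [s] nor [t], so
    [pentagon_nbr] at [r] forces it to see [x]. *)
Lemma twin_adj x y p q r s t : pentagon G p q r s t ->
  twin x p q r s t -> twin y q r s t p -> adj G x y.
Proof.
move=> C0 /(pentagon_twin C0)/pentagon_rot/pentagon_rot C2 /and4P[yr yp ys yt].
by have := pentagon_nbr C2 yr; rewrite (negPf ys) (negPf yt) adj_sym.
Qed.

(** Here [y] misses [t] but sees [q] and [s], so [pentagon_non_nbr] at [t] forces it to miss [x]. *)
Lemma twin_nadj x y p q r s t : pentagon G p q r s t ->
  twin x p q r s t -> twin y r s t p q -> ~~ adj G x y.
Proof.
move=> C0 /(pentagon_twin C0) C1 /and4P[ys yq yt yp].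
have C4 := pentagon_rot (pentagon_rot (pentagon_rot (pentagon_rot C1))).
by have := pentagon_non_nbr C4 yt; rewrite ys yq !orbF adj_sym.
Qed.

Lemma twin_uniform x z b p q r s t : pentagon G p q r s t ->
  twin x p q r s t -> adj G z q = b -> adj G z r = b -> adj G z s = b ->
  adj G z t = b -> adj G x z = b.
Proof.
move=> C0 /(pentagon_twin C0) C1 zq zr zs zt; rewrite adj_sym.
case: b zq zr zs zt => zq zr zs zt; last first.
  by apply/negbTE/negP => zx; have := pentagon_nbr C1 zx; rewrite zq zr zs.
apply/negPn/negP => zx.
by have := pentagon_non_nbr C1 zx; rewrite zq zr zt.
Qed.

Lemma pentagon_self_twin p q r s t : pentagon G p q r s t -> twin p p q r s t.
Proof.
case/andP=> /and5P[pq qr rs st tp] /and5P[pr qs rt sp tq].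
by apply/and4P; split; adjacency.
Qed.

Definition twins p q r s t := [set v | [|| twin v p q r s t, twin v q r s t p,
  twin v r s t p q, twin v s t p q r | twin v t p q r s]].

Lemma twinsP x p q r s t : x \in twins p q r s t ->
  [\/ twin x p q r s t, twin x q r s t p, twin x r s t p q
    | twin x s t p q r \/ twin x t p q r s].
Proof.
by rewrite inE => /or4P[? | ? | ? | /orP ?];
  [apply: Or41 | apply: Or42 | apply: Or43 | apply: Or44].
Qed.

Lemma twins_rot p q r s t : twins q r s t p = twins p q r s t.
Proof. by apply/setP=> v; rewrite !inE [RHS]orbC -!orbA. Qed.

Lemma twin_by_substitution v p q r s t : pentagon G p q r s t ->
  twins p q r s t = setT -> twin v p q r s t -> v != p -> by_substitution G.
Proof.
move=> C0 allT vp neq_vp; pose X := [set x | twin x p q r s t].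
apply: (@homogeneous_by_substitution _ _ X) => // [||x y z].
- have <- : #|[set v; p]| = 2 by rewrite cards2 neq_vp.
  apply: subset_leq_card; apply/subsetP=> w; rewrite !inE => /orP[]/eqP-> //.
  exact: pentagon_self_twin C0.
- by apply/eqP=> /setP/(_ q); rewrite !inE /twin adj_irrefl.
rewrite !inE => xp yp zp.
have : z \in twins p q r s t by rewrite allT.
have C1 := pentagon_rot C0; have C2 := pentagon_rot C1.
have C3 := pentagon_rot C2; have C4 := pentagon_rot C3.
case/twinsP=> [/(negP zp)//| zq | zr | [zs | zt]].
- by rewrite (twin_adj C0 xp zq) (twin_adj C0 yp zq).
- by rewrite (negPf (twin_nadj C0 xp zr)) (negPf (twin_nadj C0 yp zr)).
- rewrite (adj_sym G x z) (adj_sym G y z).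
  by rewrite (negPf (twin_nadj C3 zs xp)) (negPf (twin_nadj C3 zs yp)).
- by rewrite (adj_sym G x z) (adj_sym G y z) (twin_adj C4 zt xp) (twin_adj C4 zt yp).
Qed.

Lemma pentagon_decomposition p q r s t : pentagon G p q r s t ->
  iso G C5 \/ by_substitution G.
Proof.
move=> C0; have C1 := pentagon_rot C0; have C2 := pentagon_rot C1.
have C3 := pentagon_rot C2; have C4 := pentagon_rot C3.
(* A vertex that is no twin is complete or anticomplete to the pentagon, hence by [twin_uniform] to
   all twins: the set of twins is homogeneous. *)
have [allT|notT] := eqVneq (twins p q r s t) setT; last first.
  right; apply: (@homogeneous_by_substitution _ _ (twins p q r s t)) => // [|x y z].
    have <- : #|[set p; q]| = 2.
      by rewrite cards2; case: eqVneq C0 => // ->; rewrite /pentagon adj_irrefl.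
    apply: subset_leq_card; apply/subsetP=> w; rewrite !inE => /orP[]/eqP->.
      by rewrite (pentagon_self_twin C0).
    by rewrite (pentagon_self_twin C1) orbT.
  move=> xX yX; rewrite inE => zX.
  have [b [zp zq zr zs zt]] : exists b, [/\ adj G z p = b, adj G z q = b,
      adj G z r = b, adj G z s = b & adj G z t = b].
    have := pentagon_attachment z C0; rewrite (negPf zX) orbF.
    by case/orP=> /and5P[]; [do 5 move/negbTE=> ->; exists false
      | do 5 move=> ->; exists true].
  have zX_adj w : w \in twins p q r s t -> adj G w z = b.
    by case/twinsP=> [||| []];
      [move/(twin_uniform C0)|move/(twin_uniform C1)|move/(twin_uniform C2)
      |move/(twin_uniform C3)|move/(twin_uniform C4)]; apply.
  by rewrite !zX_adj.
(* The graph is now a blow-up of the pentagon; a sixth vertex makes one of the twin classes a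
   nontrivial homogeneous set. *)
case: (boolP [forall v, v \in [:: p; q; r; s; t]]) => [/forallP all5|].
  left; apply: iso_sym.
  have [f ef] : exists f, embeds C5 G f by apply/embeds_C5P; exists p, q, r, s, t.
  have fI := embeds_inj C5_twin_free ef.
  exists f => //; apply: inj_surj_bij => //.
  move=> v; suff /subset_cardP/(_ (subset_predT _))/(_ v) : #|codom f| = #|V|.
    by rewrite [RHS]inE => /codomP[i ->]; exists i.
  apply/eqP; rewrite eqn_leq max_card card_codom // card_ord.
  apply: leq_trans (card_size [:: p; q; r; s; t]).
  by apply: subset_leq_card; apply/subsetP=> w _; apply: all5.
move=> /forallPn[v]; rewrite !inE !negb_or => /and5P[vp vq vr vs vt]; right.
have : v \in twins p q r s t by rewrite allT.
case/twinsP=> [||| []] tw.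
- exact: twin_by_substitution C0 allT tw vp.
- by apply: (twin_by_substitution C1 _ tw vq); rewrite twins_rot.
- by apply: (twin_by_substitution C2 _ tw vr); rewrite 2!twins_rot.
- by apply: (twin_by_substitution C3 _ tw vs); rewrite 3!twins_rot.
- by apply: (twin_by_substitution C4 _ tw vt); rewrite 4!twins_rot.
Qed.

End Pentagon.

(** * Split graphs *)

(** The characterization of Foldes and Hammer. Among the maximum cliques, one of largest degree sum
    has a stable complement. *)
Lemma split_graph_of_forbidden (V : finType) (G : sgraph V) :
    free_of C5 G ->
    (forall x y z w, adj G x y -> adj G z w -> ~~ adj G x z -> ~~ adj G x w ->
       ~~ adj G y z -> ~~ adj G y w -> False) ->
    (forall x y z w, adj G x y -> adj G y z -> adj G z w -> adj G w x ->
       x != z -> ~~ adj G x z -> y != w -> ~~ adj G y w -> False) ->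
  split_graph G.
Proof.
move=> noC5 no2K2 noC4.
pose cliqueb (K : {set V}) := [forall x in K, forall y in K, (x != y) ==> adj G x y].
have cliqueP K : reflect (clique G K) (cliqueb K).
  apply: (iffP forall_inP) => [Kcl x y xK yK neq_xy | Kcl x xK].
    by have /forall_inP/(_ y yK)/implyP/(_ neq_xy) := Kcl x xK.
  by apply/forall_inP=> y yK; apply/implyP; apply: Kcl.
have cl0 : cliqueb set0 by apply/cliqueP=> x y; rewrite inE.
pose deg v := #|[set w | adj G v w]|.
case: (arg_maxnP (fun K : {set V} => #|K|) cl0) => K0 K0cl K0max.
pose maxcl (K : {set V}) := cliqueb K && (#|K| == #|K0|).
have maxcl0 : maxcl K0 by rewrite /maxcl K0cl eqxx.
case: (arg_maxnP (fun K : {set V} => \sum_(v in K) deg v) maxcl0).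
move=> K /andP[/cliqueP Kcl /eqP Kcard] Kmax.
have K_miss v : v \notin K -> exists2 k, k \in K & ~~ adj G v k.
  move=> vK; case: (boolP [exists k in K, ~~ adj G v k]) => [/exists_inP //|].
  move=> /exists_inPn vKadj.
  suff /K0max : cliqueb (v |: K) by rewrite /= cardsU1 vK Kcard add1n ltnn.
  apply/cliqueP=> x y /setU1P[->|xK] /setU1P[->|yK]; rewrite ?eqxx // => neq_xy.
  - by have := vKadj y yK; rewrite negbK.
  - by rewrite adj_sym; have := vKadj x xK; rewrite negbK.
  - exact: Kcl.
exists K, (~: K); split; rewrite ?setUCr //.
  by rewrite disjoints_subset setCK.
(* If adjacent [x] and [y] have incomparable neighbourhoods in [K], a [C4] appears; so one
   neighbourhood contains the other. *)
suff main x y : x \notin K -> y \notin K -> adj G x y ->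
    {in K, forall k, adj G x k -> adj G y k} -> False.
  move=> x y; rewrite !inE => xK yK; apply/negP => xy.
  have [/forall_inP xyK|] := boolP [forall k in K, adj G x k ==> adj G y k].
    by apply: (main x y) => // k kK; apply/implyP/xyK.
  have [/forall_inP yxK _|] := boolP [forall k in K, adj G y k ==> adj G x k].
    apply: (main y x) => //; first by rewrite adj_sym.
    by move=> k kK; apply/implyP/yxK.
  move=> /forall_inPn[k kK]; rewrite negb_imply => /andP[yk xk].
  move=> /forall_inPn[l lK]; rewrite negb_imply => /andP[xl yl].
  have neq_kl : k != l by apply: contraNneq xk => ->.
  apply: (noC4 x y k l) => //; first exact: Kcl.
  - by rewrite adj_sym.
  - by apply: contraNneq xK => ->.
  - by apply: contraNneq yK => ->.
move=> xK yK xy xyK; have [z zK yz] := K_miss y yK.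
have xz : ~~ adj G x z by apply: contra yz; apply: xyK.
(* Two vertices of [K] missed by [y], hence by [x], would form a [2K2] with [x y]. So [z] is the
   only one. *)
have yk k : k \in K -> k != z -> adj G y k.
  move=> kK neq_kz; apply/negPn/negP => yk.
  apply: (no2K2 x y k z) => //; first exact: Kcl.
  by apply: contra yk; apply: xyK.
(* Exchanging [z] for [y] in [K] gives another maximum clique, so [y] has no larger degree than [z].
   As [x] sees [y] but not [z], some neighbour [w] of [z] is missed by [y]. *)
have /subsetPn[w] : ~~ ([set w | adj G z w] \subset [set w | adj G y w]).
  apply/negP=> sub_zy.
  have lt_deg : deg z < deg y.
    apply: proper_card; apply/properP; split=> //.
    by exists x; rewrite !inE adj_sym.
  pose K' := y |: (K :\ z).
  have yKz : y \notin K :\ z by rewrite !inE negb_and yK orbT.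
  suff /Kmax : maxcl K'.
    by rewrite /= big_setU1 //= (big_setD1 z zK) /= leq_add2r leqNgt lt_deg.
  rewrite /maxcl cardsU1 yKz -Kcard (cardsD1 z K) zK eqxx andbT.
  apply/cliqueP=> u v; rewrite !inE.
  case/predU1P=> [->|/andP[uz uK]] /predU1P[->|/andP[vz vK]]; rewrite ?eqxx // => neq_uv.
  - exact: yk.
  - by rewrite adj_sym; apply: yk.
  - exact: Kcl.
rewrite !inE => zw yw.
have neq_wz : w != z by apply: contraTneq zw => ->; rewrite adj_irrefl.
have wK : w \notin K by apply: contra yw => wK; apply: yk.
have xw : adj G x w.
  by apply/negPn/negP => xw; apply: (no2K2 x y z w).
have [k kK wk] := K_miss w wK.
have neq_kz : k != z by apply: contraNneq wk => ->; rewrite adj_sym.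
have ykk := yk k kK neq_kz.
have zk : adj G z k by apply: Kcl; rewrite // eq_sym.
have [xk|xk] := boolP (adj G x k).
  apply: (noC4 k x w z) => //; try by rewrite adj_sym.
  - by apply: contraNneq wK => <-.
  - by apply: contraNneq xK => ->.
by apply: (no_C5 (p := y) (q := x) (r := w) (s := z) (t := k) noC5) => //; adjacency.
Qed.

(** * Full components of a cutset *)

Section FullPair.
Variables (V : finType) (G : sgraph V).
Hypotheses (Gfree : P5_coP5_free G) (noC5 : free_of C5 G).

(* Equivalent to connectedness of the induced subgraph on D. *)
Definition connected_set (D : {set V}) := forall (P : pred V) u w,
  u \in D -> w \in D -> P u -> ~~ P w ->
  exists p q, [/\ p \in D, q \in D, adj G p q, P p & ~~ P q].

Definition attached (S D : {set V}) :=
  forall s, s \in S -> exists2 d, d \in D & adj G s d.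

(** Models two components of [G - S] to which all of [S] is attached. Being symmetric, it makes
    every fact about [D] available for [F]. *)
Definition full_pair (S D F : {set V}) :=
  [/\ connected_set D, connected_set F, anticomplete G D F, attached S D & attached S F].

Lemma full_pair_sym S D F : full_pair S D F -> full_pair S F D.
Proof.
case=> Dc Fc DF SD SF; split=> //; apply/forall_inP=> f fF; apply/forall_inP=> d dD.
by rewrite adj_sym (anticompleteP DF dD fF).
Qed.

Lemma full_pair_nadj S D F d f : full_pair S D F -> d \in D -> f \in F -> ~~ adj G d f.
Proof. by case=> _ _ DF _ _ dD fF; rewrite (anticompleteP DF dD fF). Qed.

(** Otherwise [d' d s f f'] is an induced [P5]. *)
Lemma not_mixed_on_both S D F s d d' f f' : full_pair S D F ->
  d \in D -> d' \in D -> f \in F -> f' \in F ->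
  adj G d d' -> adj G f f' -> adj G s d -> ~~ adj G s d' -> adj G s f -> adj G s f'.
Proof.
move=> DF dD d'D fF f'F dd' ff' sd sd' sf; apply/negPn/negP => sf'.
have := (full_pair_nadj DF dD fF, full_pair_nadj DF dD f'F,
         full_pair_nadj DF d'D fF, full_pair_nadj DF d'D f'F) => -[[[df df'] d'f] d'f'].
by apply: (no_P5 (p := d') (q := d) (r := s) (s := f) (t := f') (proj1 Gfree));
  adjacency.
Qed.

(** A vertex missed on each side would yield, by connectedness, an edge on each side on which [s] is
    mixed. *)
Lemma non_neighbor_one_side S D F s d : full_pair S D F -> s \in S -> d \in D ->
  ~~ adj G s d -> {in F, forall f, adj G s f}.
Proof.
move=> DF sS dD sd f fF; apply/negPn/negP => sf; have [Dc Fc _ SD SF] := DF.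
have [d' d'D sd'] := SD s sS; have [f' f'F sf'] := SF s sS.
have [p [q [pD qD pq sp sq]]] := Dc (adj G s) d' d d'D dD sd' sd.
have [u [v [uF vF uv su sv]]] := Fc (adj G s) f' f f'F fF sf' sf.
by case/negP: sv; apply: (not_mixed_on_both DF pD qD uF vF).
Qed.

Definition common (D : {set V}) x y := [exists d in D, adj G x d && adj G y d].

Lemma no_common_edge S D F x y : full_pair S D F -> x \in S -> y \in S ->
  ~~ common D x y ->
  exists p q, [/\ p \in D, q \in D, adj G p q, adj G x p & ~~ adj G x q].
Proof.
case=> Dc _ _ SD _ xS yS /exists_inPn noc.
have [d dD xd] := SD x xS; have [e eD ye] := SD y yS.
apply: (Dc (adj G x) d e) => //.
by have := noc e eD; rewrite ye andbT.
Qed.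

(** With no common neighbour on either side, [x] would be mixed on an edge of each. *)
Lemma common_either S D F x y : full_pair S D F -> x \in S -> y \in S ->
  common D x y || common F x y.
Proof.
move=> DF xS yS; apply/negPn/negP; rewrite negb_or => /andP[noD noF].
have [p [q [pD qD pq xp xq]]] := no_common_edge DF xS yS noD.
have [u [v [uF vF uv xu xv]]] := no_common_edge (full_pair_sym DF) xS yS noF.
by move/negP: xv; apply; apply: (not_mixed_on_both DF pD qD uF vF).
Qed.

(** Walk in [D] from a vertex seen by [x] only to a neighbour of [y]. The edge [p q] where this
    property is lost gives, with [x f y], a pentagon, a [P5] or a house. *)
Lemma nonadjacent_nbr S D F x y : full_pair S D F -> x \in S -> y \in S ->
  ~~ adj G x y -> common F x y -> {in D, forall d, adj G x d -> adj G y d}.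
Proof.
move=> DF xS yS xy /exists_inP[f fF /andP[xf yf]] d dD xd; apply/negPn/negP => yd.
have [Dc _ _ SD _] := DF; have [e eD ye] := SD y yS.
have [| | p [q [pD qD pq /andP[xp yp]]]] :=
  Dc (fun z => adj G x z && ~~ adj G y z) d e dD eD; rewrite ?xd ?ye ?andbF //.
have := (full_pair_nadj DF pD fF, full_pair_nadj DF qD fF) => -[pf qf].
rewrite negb_and negbK; case: (boolP (adj G x q)) => [xq|xq] /=; last first.
  move=> _; case: (boolP (adj G y q)) => yq.
    by apply: (no_C5 (p := p) (q := x) (r := f) (s := y) (t := q) noC5); adjacency.
  by apply: (no_P5 (p := q) (q := p) (r := x) (s := f) (t := y) (proj1 Gfree));
    adjacency.
move=> yq.
by apply: (no_house (p := x) (q := q) (r := y) (s := f) (t := p) (proj2 Gfree));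
  adjacency.
Qed.

Lemma nonadjacent_common S D F x y : full_pair S D F -> x \in S -> y \in S ->
  ~~ adj G x y -> common D x y.
Proof.
move=> DF xS yS xy; case/orP: (common_either DF xS yS) => // cF.
have [_ _ _ SD _] := DF; have [d dD xd] := SD x xS.
apply/exists_inP; exists d; rewrite // xd.
exact: (nonadjacent_nbr DF xS yS).
Qed.

Lemma nonadjacent_not_mixed S D F x y : full_pair S D F -> x \in S -> y \in S ->
  ~~ adj G x y -> {in D, forall d, adj G x d = adj G y d}.
Proof.
move=> DF xS yS xy d dD; have FD := full_pair_sym DF.
have yx : ~~ adj G y x by rewrite adj_sym.
apply/idP/idP.
  by apply: (nonadjacent_nbr DF) => //; apply: nonadjacent_common FD _ _ _.
by apply: (nonadjacent_nbr DF) => //; apply: nonadjacent_common FD _ _ _.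
Qed.

(** For an edge [x y], a common neighbour [f] in [F] is the roof of a house over any square
    [x y w u] with [u], [w] in [D]. With these squares excluded, [d' d x y e] is a pentagon or a
    [P5]. *)
Lemma pair_common S D F x y : full_pair S D F -> x \in S -> y \in S -> common D x y.
Proof.
move=> DF xS yS; case: (boolP (adj G x y)) => [xy|]; last first.
  exact: nonadjacent_common DF xS yS.
have [//|noC] := boolP (common D x y); exfalso.
have := common_either DF xS yS; rewrite (negPf noC) /=.
move=> /exists_inP[f fF /andP[xf yf]].
have [d [d' [dD d'D dd' xd xd']]] := no_common_edge DF xS yS noC.
have /exists_inPn noD := noC.
have yd : ~~ adj G y d by have := noD d dD; rewrite xd.
have := (full_pair_nadj DF dD fF, full_pair_nadj DF d'D fF) => -[df d'f].
have house u w : u \in D -> w \in D -> adj G u w -> adj G x u -> ~~ adj G y u ->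
    ~~ adj G x w -> ~~ adj G y w.
  move=> uD wD uw xu yu xw; apply/negP=> yw.
  have := (full_pair_nadj DF uD fF, full_pair_nadj DF wD fF) => -[uf wf].
  by apply: (no_house (p := x) (q := y) (r := w) (s := u) (t := f) (proj2 Gfree));
    adjacency.
have yd' := house d d' dD d'D dd' xd yd xd'.
have [_ _ _ SD _] := DF; have [e eD ye] := SD y yS.
have xe : ~~ adj G x e by have := noD e eD; rewrite ye andbT.
have de : ~~ adj G d e.
  by apply/negP=> de; have := house d e dD eD de xd yd xe; rewrite ye.
case: (boolP (adj G e d')) => ed'.
  by apply: (no_C5 (p := d') (q := d) (r := x) (s := y) (t := e) noC5); adjacency.
by apply: (no_P5 (p := d') (q := d) (r := x) (s := y) (t := e) (proj1 Gfree));
  adjacency.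
Qed.

(** If [x] sees only [d] and [y] only [e], then [x] and [y] are adjacent, and the square [x y e d]
    with a common neighbour in [F] as roof is a house. *)
Lemma adjacent_comparable S D F d e : full_pair S D F -> d \in D -> e \in D ->
  adj G d e -> {in S, forall x, adj G x d -> adj G x e} \/
               {in S, forall x, adj G x e -> adj G x d}.
Proof.
move=> DF dD eD de.
have [/forall_inP sub|/forall_inPn[x xS]] :=
  boolP [forall x in S, adj G x d ==> adj G x e].
  by left=> x xS; apply/implyP/sub.
rewrite negb_imply => /andP[xd xe]; right=> y yS ye; apply/negPn/negP => yd.
have [xy|xy] := boolP (adj G x y); last first.
  by have := nonadjacent_not_mixed DF xS yS xy dD; rewrite xd (negPf yd).
have /exists_inP[f fF /andP[xf yf]] := pair_common (full_pair_sym DF) xS yS.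
have := (full_pair_nadj DF dD fF, full_pair_nadj DF eD fF) => -[df ef].
by apply: (no_house (p := x) (q := y) (r := e) (s := d) (t := f) (proj2 Gfree));
  adjacency.
Qed.

(* A vertex a of D with most neighbours in S sees all of S: otherwise walk in D
   away from a until the neighbourhood in S stops being included in that of a. *)
Lemma complete_vertex S D F d0 : full_pair S D F -> d0 \in D ->
  exists2 d, d \in D & {in S, forall s, adj G s d}.
Proof.
move=> DF d0D; pose nb d := [set s in S | adj G s d].
case: (arg_maxnP (fun d => #|nb d|) d0D) => a aD amax; exists a => // s0 s0S.
have aP d s : s \in S -> (s \in nb d) = adj G s d by rewrite inE => ->.
apply/negPn/negP => s0a.
have [Dc _ _ SD _] := DF; have [e eD s0e] := SD s0 s0S.
have [||p [q [pD qD pq pa qa]]] :=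
  Dc (fun d => nb d \subset nb a) a e aD eD; rewrite ?subxx //.
  by apply/subsetPn; exists s0; rewrite aP.
have /subsetPn[s] := qa; rewrite inE => /andP[sS sq]; rewrite aP // => sa.
have /subsetPn[l] : ~~ (nb a \subset nb q).
  apply/negP=> aq; have := amax q qD; rewrite /= leqNgt => /negP; apply.
  by apply: proper_card; rewrite properE aq.
rewrite inE => /andP[lS la]; rewrite aP // => lq.
have sub_pq : {in S, forall x, adj G x p -> adj G x q}.
  case: (adjacent_comparable DF pD qD pq) => // qp.
  case/negP: qa; apply/subsetP=> x; rewrite inE => /andP[xS xq].
  by apply: (subsetP pa); rewrite aP // qp.
have lp : ~~ adj G l p by apply: contra lq; apply: sub_pq.
have sp : ~~ adj G s p.
  apply: contra sa => sp.
  by rewrite -(aP a s sS); apply: (subsetP pa); rewrite aP.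
(* [l] and [s] show that [a] and [q] are incomparable, hence nonadjacent. Then [a l s q p] is a
   pentagon or a [P5], according to whether [a] sees [p]. *)
have aq : ~~ adj G a q.
  apply/negP=> /(adjacent_comparable DF aD qD)[] sub.
    by have := sub l lS la; rewrite (negPf lq).
  by have := sub s sS sq; rewrite (negPf sa).
have ls : adj G l s.
  apply/negPn/negP => ls.
  by have := nonadjacent_not_mixed DF lS sS ls aD; rewrite la (negPf sa).
have [ap|ap] := boolP (adj G a p).
  by apply: (no_C5 (p := a) (q := l) (r := s) (s := q) (t := p) noC5); adjacency.
by apply: (no_P5 (p := a) (q := l) (r := s) (s := q) (t := p) (proj1 Gfree));
  adjacency.
Qed.

End FullPair.

(** * Split divides *)

(** Split unification read inside [G], without markers: shrinking [C] or [A] to one vertex gives the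
    two smaller graphs, which is why both must have two vertices. The condition on anticomponents is
    reduced to nonadjacent pairs. *)
Record split_divide (V : finType) (G : sgraph V) (A B C L T : {set V}) : Prop :=
  SplitDivide {
  sd_cover : A :|: B :|: C :|: L :|: T = setT;
  sd_disjoint : pairwise (fun X Y : {set V} => [disjoint X & Y]) [:: A; B; C; L; T];
  sd_A_gt1 : 1 < #|A|;
  sd_C_gt1 : 1 < #|C|;
  sd_L_clique : clique G L;
  sd_T_stable : stable G T;
  sd_A_B : complete G A B;
  sd_A_C : anticomplete G A C;
  sd_A_T : anticomplete G A T;
  sd_T_C : anticomplete G T C;
  sd_L_BC : complete G L (B :|: C);
  sd_A_L : exists2 a, a \in A & vcomplete G a L;
  sd_C_B : exists2 c, c \in C & vcomplete G c B;
  sd_C_mixed : forall c x y, c \in C -> x \in B -> y \in B -> ~~ adj G x y ->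
    adj G c x = adj G c y
}.

Section SplitDivide.
Variables (V : finType) (G : sgraph V) (A B C L T : {set V}).

(* The marker [inr true] is a copy of the vertex [c0], the marker [inr false] a
   copy of [a0]. *)
Definition marker_map (a0 c0 : V) (u : V + bool) : V :=
  match u with inl v => v | inr true => c0 | inr false => a0 end.

Section Markers.
Variables (a0 c0 : V).
Let madj := [rel u w | adj G (marker_map a0 c0 u) (marker_map a0 c0 w)].
Fact markers_sym : symmetric madj.
Proof. by move=> u w; apply: adj_sym. Qed.
Fact markers_irrefl : irreflexive madj.
Proof. by move=> u; apply: adj_irrefl. Qed.
Definition markers : sgraph (V + bool)%type := SGraph markers_sym markers_irrefl.
End Markers.

Definition lift_set (X : {set V}) : {set V + bool} := [set inl v | v in X].

Lemma inl_lift X v : (inl v \in lift_set X) = (v \in X).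
Proof. by rewrite mem_imset // => x y []. Qed.

Lemma inr_lift X b : (inr b \in lift_set X) = false.
Proof. by apply/imsetP=> -[]. Qed.

Definition lift_setE := (inl_lift, inr_lift).

(** Both graphs of the pair are restrictions of [markers a0 c0], which lies in the class because it
    is pulled back from [G]. For [a0] complete to [L] and [c0] complete to [B], their copies satisfy
    the conditions on the markers. *)
Lemma split_divide_by_split_unification :
  P5_coP5_free G -> split_divide G A B C L T -> by_split_unification G.
Proof.
move=> Gfree sd; have [a0 a0A a0L] := sd_A_L sd; have [c0 c0C c0B] := sd_C_B sd.
pose E := markers a0 c0.
have Efree : P5_coP5_free E by apply: P5_coP5_free_pullback Gfree.
exists (V + bool)%type, (lift_set A), (lift_set B), (lift_set C), (lift_set L),
  (lift_set T), (inr false), (inr true), E, E.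
have cover v : (v \in A) || (v \in B) || (v \in C) || (v \in L) || (v \in T).
  by have /setP/(_ v) := sd_cover sd; rewrite !inE.
have := sd_disjoint sd; rewrite /= !andbT.
case/and4P=> /and4P[AB AC AL AT] /and3P[BC BL BT] /andP[CL CT] LT.
have inl_inj : injective (inl : V -> V + bool) by move=> x y [].
split.
- split; rewrite /= ?imset_disjoint ?AB ?AC ?AL ?AT ?BC ?BL ?BT ?CL ?CT ?LT //=.
  + by apply/set0Pn; exists (inl a0); rewrite lift_setE.
  + by apply/set0Pn; exists (inl c0); rewrite lift_setE.
  + by rewrite !inE !lift_setE.
  + by rewrite !inE !lift_setE.
  + move=> [x|b] [y|b']; rewrite ?lift_setE // => xL yL neq_xy.
    exact: (sd_L_clique sd).
  + by move=> [x|b] [y|b']; rewrite ?lift_setE //; apply: (sd_T_stable sd).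
  + apply/forall_inP=> -[x|b]; rewrite ?lift_setE // => xA.
    apply/forall_inP=> -[y|b]; rewrite ?lift_setE // => yB.
    exact: completeP (sd_A_B sd) xA yB.
  + apply/forall_inP=> -[x|b]; rewrite ?lift_setE // => xA.
    apply/forall_inP=> -[y|b]; rewrite ?lift_setE // => yT.
    by rewrite /= (anticompleteP (sd_A_T sd) xA yT).
  + exists (inl a0); rewrite ?lift_setE //.
    apply/forall_inP=> -[y|b]; rewrite ?lift_setE // => yL.
    exact: vcompleteP a0L yL.
  + apply/forall_inP=> -[y|b]; rewrite !inE ?lift_setE // => /orP[yB|yL] /=.
      exact: vcompleteP c0B yB.
    by rewrite adj_sym (completeP (sd_L_BC sd) yL) // inE c0C orbT.
  + apply/forall_inP=> -[y|b]; rewrite !inE ?lift_setE // => /orP[yA|yT] /=.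
      by rewrite adj_sym (anticompleteP (sd_A_C sd) yA c0C).
    by rewrite adj_sym (anticompleteP (sd_T_C sd) yT c0C).
  + apply/forall_inP=> -[x|b]; rewrite ?lift_setE // => xT.
    apply/forall_inP=> -[y|b]; rewrite ?lift_setE // => yC.
    by rewrite /= (anticompleteP (sd_T_C sd) xT yC).
  + apply/forall_inP=> -[x|b]; rewrite ?lift_setE // => xL.
    apply/forall_inP=> -[y|b]; rewrite !inE ?lift_setE // => yBC.
    by apply: completeP (sd_L_BC sd) xL _; rewrite inE.
  + apply/forall_inP=> -[y|b]; rewrite !inE ?lift_setE // => /orP[yB|yL] /=.
      exact: completeP (sd_A_B sd) a0A yB.
    exact: vcompleteP a0L yL.
  + apply/forall_inP=> -[y|b]; rewrite !inE ?lift_setE // => /orP[yC|yT] /=.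
      by rewrite (anticompleteP (sd_A_C sd) a0A yC).
    by rewrite (anticompleteP (sd_A_T sd) a0A yT).
  + exists (inl c0); rewrite ?lift_setE //.
    apply/forall_inP=> -[y|b]; rewrite ?lift_setE // => yB.
    exact: vcompleteP c0B yB.
  + move=> [c|b] X; rewrite lift_setE // => cC [Y [v ->] ->].
    (* Agreement on nonadjacent pairs of [B] propagates along paths of the complement, hence over an
       anticomponent. *)
    have constY w : connect (adj (compl (induced E (lift_set B)))) v w ->
        adj E (inl c) (val w) = adj E (inl c) (val v).
      case/connectP=> p; elim: p v w => [|u p IHp] v w /=; first by move=> _ ->.
      move=> /andP[/andP[_ vu] up] lastw; apply: etrans (IHp _ _ up lastw) _.
      case: v u vu {up lastw IHp} => [v vB] [u uB] /= vu.
      case: v vB vu => [v|b] vB vu; last by have := vB; rewrite lift_setE.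
      case: u uB vu => [u|b] uB vu; last by have := uB; rewrite lift_setE.
      by apply/esym/(sd_C_mixed sd cC); rewrite -?inl_lift.
    rewrite /mixed; case cv: (adj E (inl c) (val v)).
      suff -> : vcomplete E (inl c) [set val y | y in
        [set w | connect (adj (compl (induced E (lift_set B)))) v w]] by [].
      apply/forall_inP=> _ /imsetP[w wY ->]; rewrite inE in wY.
      by rewrite (constY w wY).
    rewrite andbC; suff -> : vanticomplete E (inl c) [set val y | y in
      [set w | connect (adj (compl (induced E (lift_set B)))) v w]] by [].
    apply/forall_inP=> _ /imsetP[w wY ->]; rewrite inE in wY.
    by rewrite (constY w wY) cv.
- have inU v : inl v \in lift_set A :|: lift_set B :|: lift_set C :|: lift_set L
                           :|: lift_set T by rewrite !inE !lift_setE.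
  exists (fun v => exist _ (inl v) (inU v)).
    apply: inj_surj_bij => [x y [] // | [[v|b] vU]]; last first.
      by exfalso; have := vU; rewrite !inE !lift_setE.
    by exists v; apply: val_inj.
  move=> x y; rewrite /= !inE !lift_setE.
  have := (cover x, cover y) => -[].
  case: (boolP (x \in C)) => xC; case: (boolP (y \in C)) => yC.
  + have -> : x \in A = false by apply: disjointFl xC.
    have -> : y \in A = false by apply: disjointFl yC.
    by rewrite !orbT /=; case: (adj G x y); rewrite ?andbF ?orbT.
  + rewrite (disjointFl AC xC) (disjointFl BC xC) (disjointFr CL xC) (disjointFr CT xC).
    case: (boolP (y \in A)) => yA /=; last by rewrite !orbF => _ ->.
    rewrite (disjointFr AB yA) (disjointFr AL yA) (disjointFr AT yA) /= => _ _.
    by rewrite adj_sym (anticompleteP (sd_A_C sd) yA xC).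
  + rewrite (disjointFl AC yC) (disjointFl BC yC) (disjointFr CL yC) (disjointFr CT yC).
    case: (boolP (x \in A)) => xA /=; last by rewrite !orbF ?andbT => ->.
    rewrite (disjointFr AB xA) (disjointFr AL xA) (disjointFr AT xA) /= => _ _.
    by rewrite (anticompleteP (sd_A_C sd) xA yC).
  + rewrite !orbF => -> -> /=.
    by case: (adj G x y); rewrite ?andbF.
- have card_lift X : #|lift_set X| = #|X| by rewrite card_imset.
  (* One marker replaces a set [X] of at least two vertices. *)
  have card_rest (X : {set V}) w (Y : {set V + bool}) : 1 < #|X| ->
      Y \subset lift_set (~: X) -> #|w |: Y| < #|V|.
    move=> X_gt1 /subset_leq_card; rewrite card_lift => Y_le.
    rewrite cardsU1 -(cardsC X); apply: leq_trans (leq_add X_gt1 Y_le).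
    by rewrite -addSn leq_add2r ltnS leq_b1.
  split; [apply: card_rest (sd_C_gt1 sd) _ | apply: card_rest (sd_A_gt1 sd) _];
    apply/subsetP=> -[v|b]; rewrite !inE !lift_setE // inE.
  + by move=> /orP[/orP[/orP[]|]|] vX; rewrite ?(disjointFr AC vX) ?(disjointFr BC vX)
      ?(disjointFl CL vX) ?(disjointFl CT vX).
  + by move=> /orP[/orP[/orP[]|]|] vX; rewrite ?(disjointFl AB vX) ?(disjointFl AC vX)
      ?(disjointFl AL vX) ?(disjointFl AT vX).
- exact: P5_coP5_free_induced.
- exact: P5_coP5_free_induced.
Qed.

End SplitDivide.

(** * Minimal separating sets *)

Lemma connect_switch (T : finType) (e : rel T) (P : pred T) u w :
    connect e u w -> P u -> ~~ P w ->
  exists p q, [/\ connect e u p, e p q, P p & ~~ P q].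
Proof.
case/connectP=> s; elim: s u => [|v s IHs] u /=; first by move=> _ -> ->.
case/andP=> uv sv lastw Pu Pw; case: (boolP (P v)) => Pv; last first.
  by exists u, v; rewrite connect0.
have [p [q [vp pq Pp Pq]]] := IHs v sv lastw Pv Pw.
by exists p, q; split=> //; apply: connect_trans vp; apply: connect1.
Qed.

Section Separation.
Variables (V : finType) (G : sgraph V).
Implicit Types (S : {set V}).

(** The edges of [G - S] as a relation on all of [V], so that components are classes of [connect]; a
    vertex of [S] is a class by itself. *)
Definition link S := [rel x y | [&& x \notin S, y \notin S & adj G x y]].
Definition comp S v := [set w | connect (link S) v w].
Definition nonisolated S v := [exists w, link S v w].
Definition separating S := [exists x, exists y,
  [&& nonisolated S x, nonisolated S y & ~~ connect (link S) x y]].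

Lemma nonisolatedI S x y : x \notin S -> y \notin S -> adj G x y -> nonisolated S x.
Proof. by move=> xS yS xy; apply/existsP; exists y; rewrite /= xS yS. Qed.

Lemma nonisolated_notin S x : nonisolated S x -> x \notin S.
Proof. by case/existsP=> y /and3P[]. Qed.

Lemma link_connect_sym S : connect_sym (link S).
Proof. by apply: sym_connect_sym => x y; rewrite /= adj_sym andbCA. Qed.

Lemma connect_link S x y : x \notin S -> y \notin S -> adj G x y -> connect (link S) x y.
Proof. by move=> xS yS xy; apply: connect1; rewrite /= xS yS. Qed.

Lemma connect_nonisolated S x y :
  nonisolated S x -> connect (link S) x y -> nonisolated S y.
Proof.
move=> nx; rewrite link_connect_sym => /connectP[[|z p] /=]; first by move=> _ <-.
by case/andP=> yz _ _; apply/existsP; exists z.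
Qed.

Lemma comp_connected S v : connected_set G (comp S v).
Proof.
move=> P u w; rewrite !inE => vu vw Pu Pw.
have uw : connect (link S) u w.
  by rewrite link_connect_sym in vu; apply: connect_trans vu vw.
have [p [q [up pq Pp Pq]]] := connect_switch uw Pu Pw.
have vp := connect_trans vu up.
exists p, q; split=> //; rewrite ?inE //; last by case/and3P: pq.
exact: connect_trans vp (connect1 pq).
Qed.

Lemma separating_other S x : separating S ->
  exists2 y, nonisolated S y & ~~ connect (link S) x y.
Proof.
case/existsP=> u /existsP[v /and3P[nu nv uv]].
have [xu|] := boolP (connect (link S) x u); last by exists u.
exists v => //; apply: contra uv => xv.
by rewrite link_connect_sym in xu; apply: connect_trans xu xv.
Qed.

Section Minimal.
Variables (S : {set V}) (minS : minset separating S).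

(** If [s] had no neighbour in the component of [x], that component would survive in the graph
    without [S :\ s], which would still be separating, against minimality. *)
Lemma comp_attached x : nonisolated S x -> attached G S (comp S x).
Proof.
move=> nx s sS.
have [/exists_inP //|/exists_inPn sx] := boolP [exists d in comp S x, adj G s d].
have /minsetP[sepS Smin] := minS; exfalso.
suff /Smin/(_ (subD1set _ _))/setP/(_ s) : separating (S :\ s).
  by rewrite !inE eqxx sS.
have sub u : u \notin S -> u \notin S :\ s by rewrite !inE negb_and orbC => ->.
have nonisolated_sub u : nonisolated S u -> nonisolated (S :\ s) u.
  case/existsP=> w /and3P[uS wS uw].
  exact: nonisolatedI (sub u uS) (sub w wS) uw.
have [y ny xy] := separating_other x sepS.
apply/existsP; exists x; apply/existsP; exists y.
rewrite !nonisolated_sub //=; apply/negP=> xy'.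
have [|p [q [_ /and3P[_ qS pq] xp xq]]] := connect_switch xy' _ xy.
  exact: connect0.
have pS : p \notin S by apply: nonisolated_notin (connect_nonisolated nx xp).
have {}qS : q \notin S.
  move: qS; rewrite !inE negb_and negbK => /orP[/eqP qs|//].
  by have := sx p; rewrite inE adj_sym -qs pq => /(_ xp).
by case/negP: xq; apply: connect_trans xp (connect_link pS qS pq).
Qed.

Lemma comp_full_pair x y : nonisolated S x -> nonisolated S y ->
  ~~ connect (link S) x y -> full_pair G S (comp S x) (comp S y).
Proof.
move=> nx ny xy; split; try exact: comp_connected; try exact: comp_attached.
apply/forall_inP=> u; rewrite inE => xu; apply/forall_inP=> w; rewrite inE => yw.
have uS := nonisolated_notin (connect_nonisolated nx xu).
have wS := nonisolated_notin (connect_nonisolated ny yw).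
apply: contra xy => uw; apply: connect_trans xu (connect_trans (connect_link uS wS uw) _).
by rewrite link_connect_sym.
Qed.

Hypotheses (Gfree : P5_coP5_free G) (noC5 : free_of C5 G).

(** Each condition comes from the full pairs formed by [A] and the component of a vertex of [C].
    Only the clique condition on [L] has to be assumed. *)
Lemma separating_split_divide x : nonisolated S x ->
  clique G [set s in S | [exists d in comp S x, ~~ adj G s d]] ->
  exists A B C L T, split_divide G A B C L T.
Proof.
set A := comp S x; set L := [set s in S | _] => nx Lcl.
pose B := S :\: L; pose C := [set v | nonisolated S v & ~~ connect (link S) x v].
pose T := [set v | (v \notin S) && ~~ nonisolated S v].
have nA v : v \in A -> nonisolated S v by rewrite inE; apply: connect_nonisolated.
have LS v : v \in L -> v \in S by rewrite inE => /andP[].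
have nonS v : v \in S -> nonisolated S v = false.
  by move=> vS; apply: contraTF vS => /nonisolated_notin.
have [y ny xy] := separating_other x (minsetp minS).
have pairC c : c \in C -> full_pair G S A (comp S c).
  by rewrite inE => /andP[nc xc]; apply: comp_full_pair.
have yC : y \in C by rewrite inE ny.
have selfC c : c \in comp S c by rewrite inE connect0.
have T_nadj t v : t \in T -> v \notin S -> ~~ adj G t v.
  rewrite inE => /andP[tS nt] vS; apply: contra nt => tv.
  exact: nonisolatedI tS vS tv.
have CS c : c \in C -> c \notin S by rewrite inE => /andP[/nonisolated_notin].
exists A, B, C, L, T; split=> //.
- apply/setP=> v; rewrite in_setT !in_setU.
  case: (boolP (v \in S)) => vS.
    by rewrite in_setD vS andbT; case: (v \in L); rewrite ?orbT.
  rewrite ![_ \in C]inE [_ \in T]inE [_ \in A]inE vS /=.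
  by case: (nonisolated S v); case: (connect _ x v); rewrite ?orbT.
- rewrite /= !andbT -!setI_eq0.
  have disj (X Y : {set V}) : (forall v, v \in X -> v \in Y -> False) -> X :&: Y == set0.
    move=> XY; apply/eqP/setP=> v; rewrite !inE; apply/negP=> /andP[].
    exact: XY.
  apply/and4P; split; [apply/and4P; split | apply/and3P; split | apply/andP; split | ];
    apply: disj => v.
  + by move=> /nA nv; rewrite in_setD => /andP[_ /nonS]; rewrite nv.
  + by rewrite !inE => -> /andP[].
  + by move=> /nA nv /LS/nonS; rewrite nv.
  + by move=> /nA nv; rewrite inE nv andbF.
  + by rewrite in_setD => /andP[_ vS] /CS; rewrite vS.
  + by rewrite in_setD => /andP[/negP].
  + by rewrite in_setD => /andP[_ vS]; rewrite inE vS.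
  + by move=> /CS vS /LS; rewrite (negPf vS).
  + by rewrite !inE => /andP[->]; rewrite andbF.
  + by move=> /LS vS; rewrite inE vS.
- have /existsP[z xz] := nx.
  have <- : #|[set x; z]| = 2.
    by rewrite cards2; case: eqVneq xz => // ->; rewrite /= adj_irrefl !andbF.
  apply: subset_leq_card; apply/subsetP=> w; rewrite !inE.
  by case/orP=> /eqP->; rewrite ?connect0 ?connect1.
- have /existsP[z yz] := ny.
  have <- : #|[set y; z]| = 2.
    by rewrite cards2; case: eqVneq yz => // ->; rewrite /= adj_irrefl !andbF.
  apply: subset_leq_card; apply/subsetP=> w /set2P[]-> //.
  have {}yz : connect (link S) y z by apply: connect1.
  rewrite inE (connect_nonisolated ny yz) /=.
  by apply: contra xy => /connect_trans; apply; rewrite link_connect_sym.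
- move=> s t sT tT; apply: T_nadj sT _; by move: tT; rewrite inE => /andP[].
- apply/forall_inP=> a aA; apply/forall_inP=> b; rewrite in_setD => /andP[bL bS].
  rewrite adj_sym; apply/negPn/negP => ba; case/negP: bL; rewrite inE bS.
  by apply/exists_inP; exists a.
- apply/forall_inP=> a aA; apply/forall_inP=> c cC.
  exact: full_pair_nadj (pairC c cC) aA (selfC c).
- apply/forall_inP=> a aA; apply/forall_inP=> t tT; rewrite adj_sym.
  exact: T_nadj tT (nonisolated_notin (nA a aA)).
- by apply/forall_inP=> t tT; apply/forall_inP=> c /CS; apply: T_nadj.
- apply/forall_inP=> l lL; apply/forall_inP=> v.
  have := lL; rewrite inE => /andP[lS /exists_inP[d dA ld]].
  case/setUP=> [|vC]; last exact: non_neighbor_one_side (pairC v vC) lS dA ld _ (selfC v).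
  (* A nonneighbour [v] of [l] in [S] agrees with [l] on [A], so it also misses [d] and belongs to
     [L]. *)
  rewrite in_setD => /andP[vL vS]; apply/negPn/negP => lv; case/negP: vL.
  rewrite inE vS; apply/exists_inP; exists d => //.
  by rewrite -(nonadjacent_not_mixed Gfree noC5 (pairC y yC) lS vS lv).
- have xA : x \in A by rewrite inE connect0.
  have [a aA aS] := complete_vertex Gfree noC5 (pairC y yC) xA.
  by exists a => //; apply/forall_inP=> l /LS/aS; rewrite adj_sym.
- have [c yc cS] := complete_vertex Gfree noC5 (full_pair_sym (pairC y yC)) (selfC y).
  move: yc; rewrite inE => yc.
  exists c; last by apply/forall_inP=> b; rewrite in_setD adj_sym => /andP[_ /cS].
  rewrite inE (connect_nonisolated ny yc) /=; apply: contra xy => /connect_trans; apply.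
  by rewrite link_connect_sym.
- move=> c u v cC; rewrite !in_setD => /andP[_ uS] /andP[_ vS] uv.
  rewrite (adj_sym G c u) (adj_sym G c v).
  have pairCA := full_pair_sym (pairC c cC).
  exact: (nonadjacent_not_mixed Gfree noC5 pairCA uS vS uv (selfC c)).
Qed.

End Minimal.
End Separation.

(** * Decomposition along a separating set *)

Lemma separating_decomposition (V : finType) (G : sgraph V) (S0 : {set V}) :
    P5_coP5_free G -> free_of C5 G -> separating G S0 ->
  by_split_unification G \/ by_split_unification (compl G).
Proof.
move=> Gfree noC5 sep0; have [S minS _] := minset_exists sep0.
have sepS := minsetp minS.
have [Scl|] := boolP [forall x in S, forall y in S, (x != y) ==> adj G x y].
  left; have /existsP[x /existsP[_ /and3P[nx _ _]]] := sepS.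
  have [|A [B [C [L [T]]]]] := separating_split_divide minS Gfree noC5 nx.
    move=> s t; rewrite !inE => /andP[sS _] /andP[tS _] neq_st.
    by have /forall_inP/(_ s sS)/forall_inP/(_ t tS)/implyP/(_ neq_st) := Scl.
  exact: split_divide_by_split_unification.
case/forall_inPn=> x0 x0S /forall_inPn[y0 y0S]; rewrite negb_imply.
case/andP=> neq_xy0 xy0; right.
(* By [non_neighbor_one_side], x0 fails to be complete to at most one component. *)
have [a na x0a] : exists2 a, nonisolated G S a &
    forall w, nonisolated G S w -> ~~ connect (link G S) a w -> adj G x0 w.
  have [/existsP[a /andP[na xa]]|/existsPn x0n] :=
      boolP [exists a, nonisolated G S a && ~~ adj G x0 a]; last first.
    have /existsP[x /existsP[_ /and3P[nx _ _]]] := sepS.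
    by exists x => // w nw _; have := x0n w; rewrite nw negbK.
  exists a => // w nw aw.
  by apply: (non_neighbor_one_side Gfree (comp_full_pair minS na nw aw) x0S _ xa);
    rewrite inE connect0.
have [c nc ac] := separating_other a sepS.
have pair_ac := comp_full_pair minS na nc ac.
have [a0 a0a a0S] : exists2 d, d \in comp G S a & {in S, forall s, adj G s d}.
  by apply: (complete_vertex Gfree noC5 pair_ac (d0 := a)); rewrite inE connect0.
have [c0 c0c c0S] : exists2 d, d \in comp G S c & {in S, forall s, adj G s d}.
  by apply: (complete_vertex Gfree noC5 (full_pair_sym pair_ac) (d0 := c));
    rewrite inE connect0.
move: a0a c0c; rewrite !inE => a0a c0c.
have na0 := connect_nonisolated na a0a; have nc0 := connect_nonisolated nc c0c.
have a0nS := nonisolated_notin na0; have c0nS := nonisolated_notin nc0.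
have ac0 : ~~ connect (link G S) a c0.
  by apply: contra ac => /connect_trans; apply; rewrite link_connect_sym.
have nonadj v w : connect (link G S) a v -> v \notin S -> w \notin S ->
    ~~ connect (link G S) a w -> ~~ adj G v w.
  move=> av vS wS; apply: contra => vw.
  exact: connect_trans av (connect_link vS wS vw).
have neq_ac0 : a0 != c0 by apply: contraNneq ac0 => <-.
have adj_ac0 := nonadj a0 c0 a0a a0nS c0nS ac0.
pose H := compl G.
(* Outside [S'] remain [S], the vertex [a0] complete to [S], and the components with an edge other
   than that of [a]. *)
pose S' := [set v | [&& v \notin S, v != a0 &
                        connect (link G S) a v || ~~ nonisolated G S v]].
have a0S' : a0 \notin S' by rewrite inE eqxx andbF.
have c0S' : c0 \notin S' by rewrite inE (negPf ac0) nc0 !andbF.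
have S_S' s : s \in S -> s \notin S' by rewrite inE => ->.
have sepS' : separating H S'.
  apply/existsP; exists x0; apply/existsP; exists a0; apply/and3P; split.
  - by apply: (nonisolatedI (y := y0)); rewrite ?S_S' //= neq_xy0.
  - by apply: (nonisolatedI (y := c0)); rewrite //= neq_ac0.
  (* No path of [H] avoiding [S'] leaves [Q]: vertices nonadjacent in [G] that lie in [S] agree on
     the other components, and [a0] is complete to [S]. *)
  pose Q z := (z \in S) && [forall w,
    nonisolated G S w && ~~ connect (link G S) a w ==> adj G z w].
  have Qx0 : Q x0.
    by rewrite /Q x0S; apply/forallP=> w; apply/implyP=> /andP[nw aw]; apply: x0a.
  have Qa0 : ~~ Q a0 by rewrite /Q (negPf a0nS).
  apply/negP=> x0a0.
  have [p [q [_ /and3P[_ qS' /andP[neq_pq pq]] /andP[pS /forallP Qp]]]] :=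
    connect_switch x0a0 Qx0 Qa0.
  case/negP.
  have qS : q \in S.
    apply/negPn/negP => qS; move: qS'; rewrite inE qS /=.
    have [qa0|_] := eqVneq q a0; first by rewrite qa0 (a0S p pS) in pq.
    rewrite negb_or negbK => /andP[aq nq].
    by have := Qp q; rewrite nq aq (negPf pq).
  rewrite /Q qS; apply/forallP=> w; apply/implyP=> /andP[nw aw].
  have pair_wa := full_pair_sym (comp_full_pair minS na nw aw).
  rewrite -(nonadjacent_not_mixed Gfree noC5 pair_wa pS qS pq) ?inE ?connect0 //.
  by apply: (implyP (Qp w)); rewrite nw aw.
have [S2 minS2 S2S'] := minset_exists sepS'.
have a0S2 : a0 \notin S2 by apply: contra a0S'; apply/subsetP.
have c0S2 : c0 \notin S2 by apply: contra c0S'; apply/subsetP.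
have [y ny c0y] := separating_other c0 (minsetp minS2).
pose Y := comp H S2 y.
(* In [H] without [S2], all remaining vertices outside [S] are connected to [c0], directly or
   through [a0]. So a component avoiding [c0] lies in [S]. *)
have YS : {subset Y <= S}.
  move=> z; rewrite inE => yz; apply/negPn/negP => zS; case/negP: c0y.
  have zS2 := nonisolated_notin (connect_nonisolated ny yz).
  suff c0z : connect (link H S2) c0 z.
    by apply: connect_trans c0z _; rewrite link_connect_sym.
  have c0a0 : connect (link H S2) c0 a0.
    by apply: connect_link; rewrite //= eq_sym neq_ac0 adj_sym.
  have [az|az] := boolP (connect (link G S) a z).
    apply: connect_link => //=; rewrite adj_sym nonadj // andbT.
    by apply: contraNneq ac0 => ->.
  have [nz|nz] := boolP (nonisolated G S z).
    apply: connect_trans c0a0 _; apply: connect_link => //=.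
    by rewrite nonadj // andbT; apply: contraNneq az => <-.
  apply: connect_link => //=; apply/andP; split.
    by apply: contraNneq nz => <-.
  by apply: contra nz => c0z; apply: (nonisolatedI (y := c0)); rewrite // adj_sym.
have Hfree := P5_coP5_free_compl Gfree; have HnoC5 := C5_free_compl noC5.
have [|A [B [C [L [T]]]]] := separating_split_divide minS2 Hfree HnoC5 ny.
  (* Isolated vertices of [G - S] are pairwise nonadjacent, hence a clique of [H]. A vertex of the
     component of [a] mixed on [Y] would distinguish an edge of [H] inside [Y], a nonadjacent pair
     of [S] in [G]. *)
  suff mixed_isolated s : s \in S2 -> [exists d in Y, ~~ adj H s d] ->
      (s \notin S) && ~~ nonisolated G S s.
    move=> s t; rewrite !inE => /andP[sS2 sY] /andP[tS2 tY] neq_st /=.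
    rewrite neq_st; have /andP[sS] := mixed_isolated s sS2 sY.
    have /andP[tS _] := mixed_isolated t tS2 tY.
    by apply: contra => st; apply: nonisolatedI sS tS st.
  move=> sS2 /exists_inP[d dY sd].
  have := subsetP S2S' s sS2; rewrite inE => /and3P[sS _ /orP[as_|->]];
    last by rewrite sS.
  have [d' d'Y sd'] := comp_attached minS2 ny sS2.
  have [p [q [pY qY /andP[_ pq] /andP[_ sp]]]] :=
    @comp_connected _ H S2 y (adj H s) d' d d'Y dY sd' sd.
  rewrite /= negb_and !negbK => /orP[/eqP sq|sq].
    by case/negP: sS; rewrite sq YS.
  have sa : s \in comp G S a by rewrite inE.
  have := nonadjacent_not_mixed Gfree noC5 pair_ac (YS p pY) (YS q qY) pq sa.
  by rewrite (adj_sym G p) (adj_sym G q) (negPf sp) sq.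
exact: split_divide_by_split_unification.
Qed.

(** Needed because [compl (compl G)] agrees with [G] only pointwise. *)
Lemma by_split_unification_ext (V : finType) (G H : sgraph V) :
  adj G =2 adj H -> by_split_unification G -> by_split_unification H.
Proof.
move=> eqGH.
move=> [U [A [B [C [L [T [as_ [cs [E1 [E2 [pair [f fbij fG] lt1 free1 free2]]]]]]]]]]].
exists U, A, B, C, L, T, as_, cs, E1, E2; split=> //.
by exists f => // x y; rewrite fG.
Qed.

Lemma two_edges_decomposition (V : finType) (G : sgraph V) x y z w :
    P5_coP5_free G -> free_of C5 G -> adj G x y -> adj G z w ->
    ~~ adj G x z -> ~~ adj G x w -> ~~ adj G y z -> ~~ adj G y w ->
  by_split_unification G \/ by_split_unification (compl G).
Proof.
move=> Gfree noC5 xy zw xz xw yz yw.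
(* Removing all other vertices leaves the two edges as components. *)
apply: (@separating_decomposition _ _ (~: [set x; y; z; w])) => //.
apply/existsP; exists x; apply/existsP; exists z; apply/and3P; split.
- by apply: (nonisolatedI (y := y)); rewrite // !inE eqxx ?orbT.
- by apply: (nonisolatedI (y := w)); rewrite // !inE eqxx ?orbT.
pose Q v := (v == x) || (v == y).
have Qx : Q x by rewrite /Q eqxx.
have Qz : ~~ Q z.
  by rewrite negb_or; apply/andP; split; apply: contraTneq zw => ->.
apply/negP=> xz_conn.
have [p [q [_ /and3P[_ qS pq] Qp Qq]]] := connect_switch xz_conn Qx Qz.
move: qS; rewrite !inE negbK -/(Q q) (negPf Qq) /=.
case/orP=> /eqP qE; case/orP: Qp => /eqP pE; move: pq; rewrite pE qE.
- by rewrite (negPf xz).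
- by rewrite (negPf yz).
- by rewrite (negPf xw).
- by rewrite (negPf yw).
Qed.

Theorem theorem5p1 (V : finType) (G : sgraph V) :
  P5_coP5_free G <->
  [\/ split_graph G,
      iso G C5,
      by_substitution G
    | by_split_unification G \/ by_split_unification (compl G)].
Proof.
split=> [Gfree|[]]; last first.
- case=> [|/by_split_unification_free]; first exact: by_split_unification_free.
  exact: P5_coP5_free_complK.
- exact: by_substitution_free.
- by move=> /P5_coP5_free_iso; apply; apply: C5_free_of_obstructions.
- exact: split_graph_free.
case: (embedsVfree G C5_twin_free) => [/embeds_C5P[p [q [r [s [t C0]]]]] | noC5].
  by case: (pentagon_decomposition Gfree C0) => ?; [apply: Or42 | apply: Or43].
pose two_edges (K : sgraph V) := [exists x, exists y, exists z, exists w,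
  [&& adj K x y, adj K z w, ~~ adj K x z, ~~ adj K x w, ~~ adj K y z & ~~ adj K y w]].
have two_edgesP (K : sgraph V) : two_edges K -> P5_coP5_free K -> free_of C5 K ->
    by_split_unification K \/ by_split_unification (compl K).
  case/existsP=> x /existsP[y /existsP[z /existsP[w]]].
  case/and5P=> xy zw xz xw /andP[yz yw] Kfree KnoC5.
  exact: two_edges_decomposition Kfree KnoC5 xy zw xz xw yz yw.
have [/two_edgesP dec|noG] := boolP (two_edges G); first by apply: Or44; apply: dec.
have [/two_edgesP dec|noH] := boolP (two_edges (compl G)).
  apply: Or44; case: dec => [||dec|dec].
  - exact: P5_coP5_free_compl.
  - exact: C5_free_compl.
  - by right.
  - by left; apply: by_split_unification_ext dec; apply: complK.
apply/Or41/split_graph_of_forbidden => // x y z w.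
  move=> xy zw xz xw yz yw; case/negP: noG.
  apply/existsP; exists x; apply/existsP; exists y; apply/existsP; exists z.
  by apply/existsP; exists w; rewrite xy zw xz xw yz yw.
move=> xy yz zw wx neq_xz xz neq_yw yw; case/negP: noH.
(* The diagonals [x z] and [y w] of a [C4] form a [2K2] in the complement. *)
apply/existsP; exists x; apply/existsP; exists z; apply/existsP; exists y.
apply/existsP; exists w.
by rewrite /= neq_xz neq_yw xz yw xy zw (adj_sym _ z y) yz (adj_sym _ x w) wx !andbF.
Qed.
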